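(* Let $(a,b)\in\mathbb{R}^2$ with $a<1$ and $b<1$. Assume that $a+b=1$. Let $\Xi_1,\Xi_2$ be smooth monotonically decreasing cut-off functions which are identically $1$ near $x=0$ and identically $0$ in an open neighborhood of the interval $[1/2,1]$. Then for $t\downarrow0$ $$\beta_{[0,1]}(x^{-a}\Xi_1,x^{-b}\Xi_2,D_{\mathbb{R}})(t)=\beta_0(a,b,\Xi_1,\Xi_2)-\frac12\log(t)+O(t^{\frac12}\log(t)),$$ where for any $\epsilon>0$ sufficiently small, $$\beta_0(a,b,\Xi_1,\Xi_2)=\frac12\log(\epsilon^2)+\frac12\gamma+\log(2^{1/2}-1)+2\log 2+\int_{[\epsilon,\frac12]}\Xi_1(x)\Xi_2(x)x^{-1}dx$$ $$\qquad+\frac12\int_{[0,1]}q^{-1}\left(\frac{(1+q)^{a-1}}{(1-q)^{a}}+\frac{(1-q)^{a-1}}{(1+q)^{a}}-\frac{2}{(1+q^2)^{1/2}}\right)dq.$$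
   Context: $D_{\mathbb{R}}:=-\partial_x^2$ on $\mathbb{R}$, with heat kernel $K_{\mathbb{R}}(x,\tilde x;t):=\frac1{\sqrt{4\pi t}}e^{-(x-\tilde x)^2/(4t)}$. For $\phi,\rho\in L^1([0,1])$ the heat content of $[0,1]$ in $\mathbb{R}$ is $\beta_{[0,1]}(\phi,\rho,D_{\mathbb{R}})(t):=\int_0^1\int_0^1K_{\mathbb{R}}(x,\tilde x;t)\phi(x)\rho(\tilde x)\,dx\,d\tilde x$ for $t>0$. $\gamma$ denotes Euler's constant. *)

(* Defs.v *)
From mathcomp Require Import all_boot all_order all_algebra.
From mathcomp Require Import all_classical all_reals all_analysis.

Set Implicit Arguments.
Unset Strict Implicit.
Unset Printing Implicit Defensive.

Import Order.TTheory GRing.Theory Num.Theory.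
Import numFieldNormedType.Exports.

Local Open Scope classical_set_scope.
Local Open Scope ring_scope.

Definition heat_kernel (R : realType) (x y t : R) : R :=
  (Num.sqrt (4 * pi * t))^-1 * expR (- (x - y) ^+ 2 / (4 * t)).

(* [\int] is here the real-valued Lebesgue integral [Rintegral]. *)
Definition heat_content (R : realType) (phi rho : R -> R) (t : R) : R :=
  \int[lebesgue_measure]_(y in `[0, 1])
    (\int[lebesgue_measure]_(x in `[0, 1])
      (heat_kernel x y t * phi x * rho y)).

(* Only the restriction of [Xi] to [0, 1] is constrained. Requiring derivatives
   of all orders on the open interval amounts to smoothness on [0, 1], since
   [Xi] is constant near both end points. *)
Definition cutoff (R : realType) (Xi : R -> R) : Prop :=
  [/\ (forall (n : nat) (x : R), 0 < x < 1 -> derivable (derive1n n Xi) x 1),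
      (forall x y : R, 0 <= x -> x <= y -> y <= 1 -> Xi y <= Xi x),
      (\forall x \near (0 : R), 0 <= x <= 1 -> Xi x = 1) &
      (exists2 U : set R, open U /\ `[2^-1, 1] `<=` U &
         forall x, U x -> 0 <= x <= 1 -> Xi x = 0)].

Definition euler_gamma (R : realType) : R :=
  limn (fun n : nat => \sum_(1 <= k < n.+1) (k%:R)^-1 - ln (n%:R : R)).

(* Main.v *)
(* Writing [x = s (1 + q)], [y = s (1 - q)] turns the heat content into a single
   integral over [-1 < q < 1] of the weight [(1 - q)^(a-1) (1 + q)^(-a)] (all
   powers of [s] cancel because [a + b = 1]) times a Gaussian integral in [s].
   Folding [q] and [-q] together, the weight [F q] satisfies
   [2 <= F q <= 2 / (1 - q^2)]; since the cut-offs are Lipschitz, they may be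
   replaced by their values on the diagonal [q = 0] up to [O(sqrt t)].  The part
   [F - 2] then contributes [1/2 \int (F q - 2) / q dq], and the remaining part
   contributes [\int Xi1 Xi2 / x] away from [0] and, near [0],
   [\int_0^M erf v / v dv] with [M = d / sqrt t].  The asymptotics
   [\int_0^M erf v / v dv = ln M + gamma / 2 + ln 2 + O(1/M)] follow by comparing
   [e^(-n z)] with [(1 - z)^n], for which the integral is the exact ratio
   [1 + 1/3 + ... + 1/(2n+1)].  The term [2 / sqrt(1 + q^2)] of the statement
   only moves a constant, [\int_0^1 (1 - 1/sqrt(1+q^2)) / q dq =
   ln(1 + sqrt 2) - ln 2]. *)
Require Import Defs.
From mathcomp Require Import all_boot all_order all_algebra.
From mathcomp Require Import all_classical all_reals all_analysis.
From mathcomp Require Import measurable_realfun ring lra.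

Set Implicit Arguments.
Unset Strict Implicit.
Unset Printing Implicit Defensive.

Import Order.TTheory GRing.Theory Num.Theory.
Import numFieldNormedType.Exports.

Local Open Scope classical_set_scope.
Local Open Scope ring_scope.

(** * Affine changes of variables and Gaussian integrals *)

Section Affine.
Context {R : realType}.
Local Notation mu := (@lebesgue_measure R).

(** Two singularities shape the estimates. For fixed [q] the Gaussian integral in [s] tends to
    [1/(2q)], which is not integrable at [q = 0]. Against the constant 2 this produces the
    logarithm, so that part is kept exact and integrated in [q] before [s]; [F - 2] is [O(q^2)] at 0
    and can be multiplied by the limit. At [q = 1] the bound [2/(1 - q^2)] is not integrable whereas
    [F] is, so errors there are kept as multiples of [F] itself, through [F - 2 <= q^2 F]. Moving
    the cut-offs to the diagonal costs [|q|] against a prefactor of order [1/sqrt t], which alone is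
    not small. But both cut-offs equal 1 as long as [s <= d], so only [s > d] contributes, where the
    Gaussian is at most [e^(-d^2 q^2/t)]; the gain is [\int_0^1 q e^(-d^2 q^2/t) dq <= t/(2
    d^2)]. *)

Lemma measurable_affine (c d : R) :
  measurable_fun setT ((fun x : R => c * x + d) : measurableTypeR R -> measurableTypeR R).
Proof. by apply: measurable_funD => //; apply: measurable_funM. Qed.

(** The pushforward under the affine map, scaled by [|c|], agrees with Lebesgue measure on half-open
    intervals, and these determine it. For [c < 0] the preimage is closed at the other end, hence
    the two cases. *)
Lemma lebesgue_measure_affine (c d : R) (A : set (measurableTypeR R)) :
  c != 0 -> measurable A ->
  (mu A = `|c|%:E * mu ((fun x : R => (c * x + d)%R) @^-1` A))%E.
Proof.
move=> c0 mA.
pose nu := mscale (NngNum (normr_ge0 c))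
  (measure_function_pushforward__canonical__measure_function_Measure mu
    (measurable_affine c d)).
rewrite [LHS](lebesgue_measure_unique (mu := nu)) => // _ [[u v]] _ <-.
rewrite /nu /= /mscale/= /pushforward.
have [cp|cn] := ltP 0 c.
  have -> : (fun x : R => c * x + d) @^-1` `]u, v] = `](u - d) / c, (v - d) / c]%classic.
    by apply/seteqP; split => x /=; rewrite !in_itv/= ltr_pdivrMr// ler_pdivlMr//
      ltrBlDr lerBrDr (mulrC x).
  rewrite !lebesgue_measure_itv/= !lte_fin ltr_pM2r ?invr_gt0// ltrD2r.
  case: ifP => _; last by rewrite mule0.
  rewrite -!EFinB -EFinM gtr0_norm//; congr EFin; field.
  by rewrite gt_eqF.
have {}cn : c < 0 by rewrite lt_neqAle c0.
have -> : (fun x : R => c * x + d) @^-1` `]u, v] = `[(v - d) / c, (u - d) / c[%classic.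
  by apply/seteqP; split => x /=; rewrite !in_itv/= ltr_ndivlMr// ler_ndivrMr//
      ltrBlDr lerBrDr (mulrC x) andbC.
rewrite !lebesgue_measure_itv/= !lte_fin ltr_nM2r ?invr_lt0// ltrD2r.
case: ifP => _; last by rewrite mule0.
rewrite -!EFinB -EFinM ltr0_norm//; congr EFin; field.
by rewrite lt_eqF.
Qed.

Lemma ge0_integral_affine (c d : R) (f : R -> \bar R) :
  c != 0 -> measurable_fun setT f -> (forall x, 0 <= f x)%E ->
  (\int[mu]_x f x = `|c|%:E * \int[mu]_x f (c * x + d)%R)%E.
Proof.
move=> c0 mf f0.
pose nu0 := (measure_function_pushforward__canonical__measure_function_Measure mu
    (measurable_affine c d)).
pose nu := mscale (NngNum (normr_ge0 c)) nu0.
rewrite (eq_measure_integral nu); last first.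
  by move=> A mA _; rewrite /= (lebesgue_measure_affine d c0).
rewrite ge0_integral_mscale//= ge0_integral_pushforward//=; exact: measurable_affine.
Qed.

Lemma ge0_integral_scale01 (c : R) (f : R -> R) :
  0 < c -> measurable_fun `[0, c] f -> (forall x, 0 <= x <= c -> 0 <= f x) ->
  (\int[mu]_(x in `[0%R, c]) (f x)%:E =
    c%:E * \int[mu]_(y in `[0%R, 1%R]) (f (c * y))%:E)%E.
Proof.
move=> c0 mf f0.
rewrite integral_mkcond (@ge0_integral_affine c 0) ?gt_eqF//; last first.
- move=> x; rewrite patchE; case: ifPn => //; rewrite inE/= in_itv/= => xc.
  by rewrite lee_fin f0.
- by apply/(measurable_restrictT _ _).1 => //; apply/measurable_EFinP.
rewrite gtr0_norm// [in RHS]integral_mkcond; congr (_ * _)%E.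
apply: eq_integral => x _; rewrite addr0 !patchE.
rewrite !mem_setE !in_itv/= pmulr_rge0// -[X in _ * _ <= X]mulr1 ler_pM2l//.
Qed.

End Affine.

(** * Integrals over segments and the fundamental theorem of calculus *)

Section IntervalIntegrals.
Context {R : realType}.
Local Notation mu := (@lebesgue_measure R).

Lemma within_continuous (D : set R) (f : R -> R) :
  (forall x, D x -> {for x, continuous f}) -> {within D, continuous f}.
Proof.
by move=> cf; apply: continuous_in_subspaceT => x; rewrite inE => /cf.
Qed.

Lemma continuous_itv_integrable (a b : R) (f : R -> R) :
  (forall x, a <= x <= b -> {for x, continuous f}) ->
  mu.-integrable `[a, b] (EFin \o f).
Proof.
move=> cf; apply: continuous_compact_integrable; first exact: segment_compact.
by apply: within_continuous => x /=; rewrite in_itv/= => /cf.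
Qed.

Lemma bounded_itv_integrable (a b B : R) (f : R -> R) :
  measurable_fun `[a, b] f -> (forall x, a <= x <= b -> `|f x| <= B) ->
  mu.-integrable `[a, b] (EFin \o f).
Proof.
move=> mf fB; apply: measurable_bounded_integrable => //.
  by rewrite -[X in (X < _)%E]/(mu _) lebesgue_measure_itv/=; case: ifP => //;
    rewrite -EFinD ltry.
exists B; split; first exact: num_real.
move=> x Bx y /=; rewrite in_itv/= => /fB /le_trans; apply; exact: ltW.
Qed.

Lemma FTC2_is_derive (a b : R) (F f : R -> R) :
  a <= b -> (forall x, a <= x <= b -> is_derive x 1 F (f x)) ->
  (forall x, a <= x <= b -> {for x, continuous f}) ->
  (\int[mu]_(x in `[a, b]) (f x)%:E = (F b - F a)%:E)%E.
Proof.
rewrite le_eqVlt => /predU1P[<- _ _|ab dF cf].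
  by rewrite set_itv1 integral_set1 subrr.
have cF x : a <= x <= b -> {for x, continuous F}.
  move=> /dF [dFx _]; exact/differentiable_continuous/derivable1_diffP.
rewrite (continuous_FTC2 (F := F) ab) ?EFinB//.
- by apply: within_continuous => x /=; rewrite in_itv/= => /cf.
- split.
  + by move=> x; rewrite in_itv/= => /andP[/ltW ax /ltW xb]; case: (dF x); rewrite ?ax.
  + by apply: cvg_at_right_filter; apply: cF; rewrite lexx ltW.
  + by apply: cvg_at_left_filter; apply: cF; rewrite lexx ltW.
- move=> x; rewrite in_itv/= => /andP[/ltW ax /ltW xb].
  by rewrite derive1E; case: (dF x); rewrite ?ax.
Qed.

Lemma RFTC2_is_derive (a b : R) (F f : R -> R) :
  a <= b -> (forall x, a <= x <= b -> is_derive x 1 F (f x)) ->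
  (forall x, a <= x <= b -> {for x, continuous f}) ->
  \int[mu]_(x in `[a, b]) f x = F b - F a.
Proof. by move=> ab dF cf; rewrite /Rintegral (FTC2_is_derive ab dF cf). Qed.

Lemma Rintegral_itv_split (a b c : R) (f : R -> R) :
  a <= b -> b <= c -> mu.-integrable `[a, c] (EFin \o f) ->
  \int[mu]_(x in `[a, c]) f x =
  \int[mu]_(x in `[a, b]) f x + \int[mu]_(x in `[b, c]) f x.
Proof.
move=> ab bc intf.
have := @Rintegral_itvB R f (BLeft a) (BRight c) b intf.
rewrite !bnd_simp => /(_ ab bc)/eqP; rewrite subr_eq => /eqP ->.
rewrite addrC Rintegral_itv_obnd_cbnd//.
by apply: integrableS intf => //; apply: subset_itv; rewrite bnd_simp.
Qed.

Lemma Rintegral_le_cst (a b B : R) (f : R -> R) : a <= b ->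
  mu.-integrable `[a, b] (EFin \o f) -> (forall x, a <= x <= b -> f x <= B) ->
  \int[mu]_(x in `[a, b]) f x <= B * (b - a).
Proof.
move=> ab intf fB.
have -> : B * (b - a) = \int[mu]_(x in `[a, b]) B.
  rewrite Rintegral_cst//= lebesgue_measure_itv/= lte_fin.
  case: ltP => [//|ba]; have -> : a = b by apply/le_anti; rewrite ab ba.
  by rewrite subrr.
apply: le_Rintegral => //.
by apply: continuous_itv_integrable => x _; exact: cvg_cst.
Qed.

End IntervalIntegrals.

(** Since [0^-1 = 0], inversion is [x] times the power [-1] of [x^2], a product of measurable
    functions; the discontinuity at 0 needs no splitting of the domain. *)
Lemma measurable_inv (R : realType) : measurable_fun setT (@GRing.inv R).
Proof.
rewrite (_ : GRing.inv = (fun x : R => x * (x ^+ 2) `^ (-1))).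
  apply: measurable_funM => //.
  exact: (@measurableT_comp _ _ _ _ _ _ (@powR R ^~ (-1))).
apply/funext => x; rewrite powR_inv1 ?sqr_ge0//.
have [->|x0] := eqVneq x 0; first by rewrite invr0 mul0r.
by rewrite expr2 invfM mulrA divff// mul1r.
Qed.

(** * Gaussian integrals with explicit tails *)

Section Gauss.
Context {R : realType}.
Local Notation mu := (@lebesgue_measure R).

Lemma continuous_gauss_scale (k : R) : continuous (fun s : R => expR (- (k * s) ^+ 2)).
Proof.
move=> s; apply: (@continuous_comp _ _ _ (fun s : R => k * s) gauss_fun).
  by apply: mulrl_continuous.
exact: continuous_gauss_fun.
Qed.

(** From [e^(x^2) >= 1 + x^2 >= x^2] the integrand is at most [x^-2], whose integral over the
    half-line is [1/M]. *)
Lemma gauss_tail (M : R) : 0 < M ->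
  (\int[mu]_(x in `[M, +oo[) (gauss_fun x)%:E <= (M^-1)%:E)%E.
Proof.
move=> M0.
have -> : (M^-1)%:E = (\int[mu]_(x in `[M, +oo[) (x ^- 2)%:E)%E.
  rewrite (ge0_continuous_FTC2y (F := fun x => - x^-1) (l := 0)) ?EFinN ?oppeK ?add0e//.
  - by move=> x Mx; rewrite invr_ge0 exprn_ge0// (le_trans _ Mx)// ltW.
  - apply: within_continuous => x /=; rewrite in_itv/= andbT => Mx.
    have x0 : 0 < x by exact: lt_le_trans Mx.
    apply: cvgV; first by rewrite gt_eqF// exprn_gt0.
    exact: exprn_continuous.
  - rewrite -oppr0; apply: cvgN.
    by apply: (@gtr0_cvgV0 R R +oo%R _ id _).2 => //; exact: nbhs_pinfty_gt.
  - move=> x Mx; have x0 : 0 < x by exact: lt_trans Mx.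
    apply: derivableN; apply: derivableV => //; by rewrite gt_eqF.
  - apply: cvg_at_right_filter; apply: cvgN; apply: cvgV => //.
    by rewrite gt_eqF.
  - move=> x; rewrite in_itv/= andbT => Mx.
    have x0 : 0 < x by exact: lt_trans Mx.
    rewrite derive1E deriveN; last by apply: derivableV => //; rewrite gt_eqF.
    by rewrite deriveV ?gt_eqF// derive_id scaleNr opprK scaler1.
apply: ge0_le_integral => //=.
- by move=> x _; rewrite lee_fin gauss_fun_ge0.
- by apply/measurable_EFinP; apply: measurable_funTS; exact: measurable_gauss_fun.
- apply/measurable_EFinP; apply: measurable_funTS; apply: measurableT_comp;
    first exact: measurable_inv.
  exact: measurable_funX.
- move=> x; rewrite in_itv/= andbT => Mx.
  have x0 : 0 < x by exact: lt_le_trans Mx.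
  rewrite lee_fin /gauss_fun expRN lef_pV2 ?posrE ?expR_gt0 ?exprn_gt0//.
  by rewrite (le_trans _ (expR_ge1Dx _))// lerDr.
Qed.

(** Rescaling by [k] gives the half-line integral [sqrt pi / 2] truncated at [k c]; [gauss_tail]
    bounds what is cut off by [1/(k c)]. *)
Lemma gauss_itv_bounds (k c : R) : 0 < k -> 0 < c ->
  Num.sqrt pi / (2 * k) - (k ^+ 2 * c)^-1 <=
  \int[mu]_(s in `[0, c]) expR (- (k * s) ^+ 2) <= Num.sqrt pi / (2 * k).
Proof.
move=> k0 c0.
have kc0 : 0 < k * c by rewrite mulr_gt0.
have mg (D : set R) : measurable_fun D (EFin \o gauss_fun).
  by apply/measurable_EFinP; apply: measurable_funTS; exact: measurable_gauss_fun.
have sc : (\int[mu]_(x in `[0%R, (k * c)%R]) (gauss_fun x)%:E =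
   k%:E * \int[mu]_(s in `[0%R, c]) (expR (- (k * s) ^+ 2))%:E)%E.
  rewrite ge0_integral_scale01//; last first.
    apply: measurable_funTS; apply: continuous_measurable_fun.
    exact: continuous_gauss_scale.
  rewrite [LHS]ge0_integral_scale01//; last first.
  - by move=> x _; exact: gauss_fun_ge0.
  - by apply: measurable_funTS; exact: measurable_gauss_fun.
  rewrite muleA -EFinM; congr (_ * _)%E.
  by apply: eq_integral => x _; rewrite mulrA.
have intg : mu.-integrable `[0, c] (EFin \o (fun s => expR (- (k * s) ^+ 2))).
  by apply: continuous_itv_integrable => x _; exact: continuous_gauss_scale.
set I := \int[mu]_(s in _) _.
have IE : (\int[mu]_(x in `[0%R, (k * c)%R]) (gauss_fun x)%:E = (k * I)%:E)%E.
  by rewrite sc /I /Rintegral EFinM fineK//; exact: integrable_fin_num intg.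
have up : k * I <= Num.sqrt pi / 2.
  rewrite -lee_fin -IE -integral0y_gauss; apply: ge0_subset_integral => //.
  - exact: mg.
  - by move=> x _; rewrite lee_fin gauss_fun_ge0.
  - by apply: subset_itv; rewrite bnd_simp.
have lo : Num.sqrt pi / 2 <= k * I + (k * c)^-1.
  rewrite -lee_fin EFinD -IE -integral0y_gauss.
  rewrite (@itv_bndbnd_setU _ _ _ (BRight (k * c)))//; last by rewrite bnd_simp ltW.
  rewrite ge0_integral_setU//=; last 3 first.
  - exact: mg.
  - by move=> x _; rewrite lee_fin gauss_fun_ge0.
  - apply/disj_setPRL => x /=; rewrite !in_itv/= andbT => kx /andP[_].
    by rewrite leNgt kx.
  rewrite leeD2l// (le_trans _ (gauss_tail kc0))//.
  by rewrite integral_itv_obnd_cbnd//.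
have E1 : Num.sqrt pi / (2 * k) = (Num.sqrt pi / 2) / k.
  by rewrite invfM mulrA.
have E2 : (k ^+ 2 * c)^-1 = (k * c)^-1 / k by rewrite -invfM; congr (_^-1); ring.
rewrite E1 E2 -mulrBl ler_pdivrMr// ler_pdivlMr// [I * k]mulrC up andbT.
by rewrite lerBlDr.
Qed.

End Gauss.

(** * Comparison of integrals and dependence on a parameter *)

Section ParameterIntegrals.
Context {R : realType}.
Local Notation mu := (@lebesgue_measure R).

Lemma is_derive_continuous (f : R -> R) (x df : R) :
  is_derive x 1 f df -> {for x, continuous f}.
Proof. by move=> [? _]; exact/differentiable_continuous/derivable1_diffP. Qed.

Lemma Rintegral_dist_le (a b B : R) (f g : R -> R) : a <= b ->
  mu.-integrable `[a, b] (EFin \o f) -> mu.-integrable `[a, b] (EFin \o g) ->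
  (forall x, a <= x <= b -> `|f x - g x| <= B) ->
  `|\int[mu]_(x in `[a, b]) f x - \int[mu]_(x in `[a, b]) g x| <= B * (b - a).
Proof.
move=> ab fi gi fB; rewrite -RintegralB//.
have hI : mu.-integrable `[a, b] (EFin \o (fun t => f t - g t)).
  by have /(_ (measurable_itv _)) := integrableB _ fi gi.
apply: (le_trans (le_normr_Rintegral _ hI)) => //.
apply: Rintegral_le_cst => //.
exact: (@integrable_norm _ _ _ mu _ (fun t => f t - g t)).
Qed.

Lemma measurable_Rintegral_param (D : set R) (f : R -> R -> R) :
  measurable D -> measurable_fun setT (fun z : R * R => f z.1 z.2) ->
  (forall x y, 0 <= f x y) ->
  measurable_fun setT (fun x => \int[mu]_(y in D) f x y).
Proof.
move=> mD mf f0.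
pose g (z : R * R) : \bar R := (f z.1 z.2 * \1_D z.2)%:E.
have mg : measurable_fun setT g.
  apply/measurable_EFinP; apply: measurable_funM => //.
  by apply: measurableT_comp => //; exact: measurable_indic.
have g0 z : (0 <= g z)%E by rewrite lee_fin mulr_ge0.
have := @measurable_fun_fubini_tonelli_F _ _ _ _ R mu g mg g0.
move=> mF; rewrite (_ : (fun x => _) = fine \o fubini_F mu g).
  exact: measurableT_comp.
apply/funext => x /=; rewrite /Rintegral /fubini_F; congr fine.
rewrite integral_mkcond; apply: eq_integral => y _.
by rewrite /g /= epatch_indic/= EFinM.
Qed.

End ParameterIntegrals.

(** * Differentiation rules for functions written pointwise *)

Section Pointwise.
Context {R : realType}.
Implicit Types (f g : R -> R) (x df dg : R).

Lemma is_derive_ptM f g x df dg : is_derive x 1 f df -> is_derive x 1 g dg ->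
  is_derive x 1 (fun y => f y * g y) (f x * dg + g x * df).
Proof. exact: is_deriveM. Qed.

Lemma is_derive_ptD f g x df dg : is_derive x 1 f df -> is_derive x 1 g dg ->
  is_derive x 1 (fun y => f y + g y) (df + dg).
Proof. exact: is_deriveD. Qed.

Lemma is_derive_ptN f x df : is_derive x 1 f df ->
  is_derive x 1 (fun y => - f y) (- df).
Proof. exact: is_deriveN. Qed.

Lemma is_derive_ptX f n x df : is_derive x 1 f df ->
  is_derive x 1 (fun y => f y ^+ n) (n%:R * f x ^+ n.-1 * df).
Proof.
move=> dfx; rewrite (_ : (fun y => _) = f ^+ n); first exact: is_deriveX.
elim: n => [|n IH]; first by rewrite expr0; apply/funext => y; rewrite expr0.
by rewrite exprS -IH; apply/funext => y; rewrite exprS.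
Qed.

Lemma is_derive_ptc (c : R) x : is_derive x 1 (fun=> c) 0.
Proof. exact: is_derive_cst. Qed.

Lemma is_derive_ptid x : is_derive x 1 (fun y : R => y) 1.
Proof. exact: is_derive_id. Qed.

Lemma is_derive_ptcomp (h : R -> R) f x a df :
  is_derive (f x) 1 h a -> is_derive x 1 f df ->
  is_derive x 1 (fun y => h (f y)) (a * df).
Proof. exact: is_derive1_comp. Qed.

End Pointwise.

Ltac isd := repeat (first [exact: is_derive_ptc | exact: is_derive_ptid
  | apply: is_derive_ptN | apply: is_derive_ptX
  | apply: is_derive_ptD | apply: is_derive_ptM ]).

(** * The asymptotics of the integral of erf(v) / v *)

Section Wallis.
Context {R : realType}.
Local Notation mu := (@lebesgue_measure R).
Implicit Types (n : nat) (y : R).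

(** Polynomial counterpart of [\int_0^1 e^(-n (y q)^2) dq], with [(1 - z)^n] in place of [e^(-n z)].
    At [y = 1] it is the classical Wallis integral. *)
Definition wallis_int n y := \int[mu]_(q in `[0, 1]) (1 - (y * q) ^+ 2) ^+ n.



Lemma is_derive_wallis n y (x : R) : is_derive x 1 (fun q : R => (1 - (y * q) ^+ 2) ^+ n)
  (n%:R * (1 - (y * x) ^+ 2) ^+ n.-1 * (- 2 * y ^+ 2 * x)).
Proof.
apply: is_derive_eq; first by isd.
rewrite /= /GRing.scale/=; set P := _ ^+ n.-1.
by ring.
Qed.

(** Writing [(y q)^2] as [1 - (1 - (y q)^2)] in the product rule leaves two consecutive powers only;
    integration over [[0, 1]] then gives the recurrence [wallis_intS]. *)
Lemma is_derive_xwallis n y (x : R) : is_derive x 1 (fun q : R => q * (1 - (y * q) ^+ 2) ^+ n.+1)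
  (n.*2.+3%:R * (1 - (y * x) ^+ 2) ^+ n.+1 - n.*2.+2%:R * (1 - (y * x) ^+ 2) ^+ n).
Proof.
apply: is_derive_eq.
  exact: (is_derive_ptM (is_derive_ptid x) (is_derive_wallis n.+1 y x)).
have E3 : n.*2.+3%:R = 2 * n%:R + 3 :> R by rewrite -muln2 -addn3 natrD natrM mulrC.
have E2 : n.*2.+2%:R = 2 * n%:R + 2 :> R by rewrite -muln2 -addn2 natrD natrM mulrC.
rewrite /= E3 E2 -natr1; set z := 1 - (y * x) ^+ 2; rewrite (exprS z n).
by rewrite /z; set P := _ ^+ n; ring.
Qed.

Lemma wallis_intS n y : n.*2.+3%:R * wallis_int n.+1 y =
  (1 - y ^+ 2) ^+ n.+1 + n.*2.+2%:R * wallis_int n y.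
Proof.
have cw m : mu.-integrable `[0, 1] (EFin \o (fun q : R => (1 - (y * q) ^+ 2) ^+ m)).
  by apply: continuous_itv_integrable => x _;
    exact: is_derive_continuous (is_derive_wallis m y x).
apply/eqP; rewrite -subr_eq; apply/eqP.
rewrite /wallis_int -!RintegralZl// -RintegralB//; last 2 first.
- by apply: (integrableZl _ _ (cw _)).
- by apply: (integrableZl _ _ (cw _)).
rewrite (RFTC2_is_derive ler01 (fun x _ => is_derive_xwallis n y x)); last first.
  move=> x _; have cw' m := is_derive_continuous (is_derive_wallis m y x).
  by apply: cvgB; (apply: cvgM; first exact: cvg_cst); exact: cw'.
by rewrite mul0r subr0 mul1r mulr1.
Qed.

Lemma wallis_int0 y : wallis_int 0 y = 1.
Proof.
rewrite /wallis_int (@eq_Rintegral _ _ _ _ _ (cst 1)); last by move=> x _; rewrite expr0.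
by rewrite Rintegral_cst//= lebesgue_measure_itv/= lte_fin ltr01 oppr0 addr0 mulr1.
Qed.

(** By the recurrence this is a polynomial in [y], so no theorem on continuity under the integral
    sign is involved. *)
Lemma continuous_wallis_int n : continuous (wallis_int n).
Proof.
elim: n => [|n IH] /= y.
  by rewrite (_ : wallis_int 0 = cst 1); [exact: cvg_cst | apply/funext; exact: wallis_int0].
have -> : wallis_int n.+1 = (fun y => n.*2.+3%:R^-1 * ((1 - y ^+ 2) ^+ n.+1 + n.*2.+2%:R *
  wallis_int n y)).
  by apply/funext => z; rewrite -wallis_intS mulKf.
have cy : {for (y : R), continuous (fun z : R => (1 - z ^+ 2) ^+ n.+1)}.
  by apply: is_derive_continuous; isd.
apply: cvgM; first exact: cvg_cst.
apply: cvgD; last by apply: cvgM; [exact: cvg_cst | exact: IH].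
exact: cy.
Qed.

Definition odd_harmonic n : R := \sum_(k < n.+1) (k.*2.+1%:R)^-1.

(** Let [J_n] be the left side and [w_n] the value at [y = 1]. Integrating the recurrence in [y]
    gives [(2n+3) J_(n+1) = w_(n+1) + (2n+2) J_n], while at [y = 1] it reads
    [(2n+3) w_(n+1) = (2n+2) w_n]. Hence [J_n / w_n] grows by exactly [1/(2n+3)]. *)
Lemma Rintegral_wallis_int n :
  \int[mu]_(y in `[0, 1]) wallis_int n y = wallis_int n 1 * odd_harmonic n.
Proof.
have iw m : mu.-integrable `[0, 1] (EFin \o wallis_int m).
  by apply: continuous_itv_integrable => x _; exact: continuous_wallis_int.
elim: n => [|n IH].
  rewrite wallis_int0 /odd_harmonic big_ord1 invr1 mulr1 .
  rewrite (@eq_Rintegral _ _ _ _ _ (cst 1)); last by move=> y _; exact: wallis_int0.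
  by rewrite Rintegral_cst//= lebesgue_measure_itv/= lte_fin ltr01 oppr0 addr0 mulr1.
have n0 : (n.*2.+3%:R : R) != 0 by [].
apply: (mulfI n0); rewrite -RintegralZl//.
rewrite (_ : \int[mu]_(x in _) _ = wallis_int n.+1 1 + n.*2.+2%:R * \int[mu]_(y in `[0, 1])
  wallis_int n y).
  rewrite IH /odd_harmonic [in RHS]big_ord_recr/= -/(odd_harmonic n).
  have := wallis_intS n 1; rewrite expr1n subrr expr0n/= add0r => E.
  by rewrite doubleS mulrA -E -mulrA !mulrDr [X in _ = _ + X]mulrCA mulfV// mulr1 addrC.
rewrite -RintegralZl//; under eq_Rintegral do rewrite wallis_intS.
rewrite RintegralD//.
- congr (_ + _); rewrite /wallis_int; apply: eq_Rintegral => x _; by rewrite mul1r.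
- by apply: continuous_itv_integrable => x _; apply: is_derive_continuous; isd.
- by apply: (integrableZl _ _ (iw _)).
Qed.

End Wallis.

(** * Harmonic sums and Euler's constant *)

Section Harmonic.
Context {R : realType}.

Definition harm n : R := \sum_(1 <= k < n.+1) (k%:R)^-1.

Lemma harmS n : harm n.+1 = harm n + n.+1%:R^-1.
Proof. by rewrite /harm big_nat_recr. Qed.

Lemma odd_harmonicE n : @odd_harmonic R n = harm n.*2.+1 - 2^-1 * harm n.
Proof.
elim: n => [|n IH].
  by rewrite /odd_harmonic /harm big_ord1 big_nat1 big_geq// mulr0 subr0.
rewrite /odd_harmonic big_ord_recr/= -/(odd_harmonic n) IH doubleS !harmS.
rewrite (_ : n.*2.+2%:R = 2 * n.+1%:R :> R); last by rewrite -natrM mul2n doubleS.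
rewrite -doubleS invfM. set u := 2^-1; set v := n.+1%:R^-1; ring.
Qed.

Lemma ln_le_sub1 (x : R) : 0 < x -> ln x <= x - 1.
Proof.
move=> x0; have /le_ln1Dx : -1 < x - 1 by rewrite ltrBrDr addNr.
by rewrite [1 + _]addrC subrK.
Qed.

Lemma ln_succ_bounds n : (n.+2%:R : R)^-1 <= ln n.+2%:R - ln (n.+1%:R : R) <= n.+1%:R^-1.
Proof.
have n1 : 0 < n.+1%:R :> R by [].
have n2 : 0 < n.+2%:R :> R by [].
have E : n.+2%:R = n.+1%:R + 1 :> R by rewrite natr1.
apply/andP; split.
  rewrite -lerN2 opprB -ln_div ?posrE//.
  apply: (le_trans (ln_le_sub1 _)); first by rewrite divr_gt0.
  rewrite le_eqVlt; apply/orP; left; apply/eqP; rewrite E; field.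
  by have := ler0n R n => n0; rewrite gt_eqF//; lra.
rewrite -ln_div ?posrE//.
apply: (le_trans (ln_le_sub1 _)); first by rewrite divr_gt0.
rewrite le_eqVlt; apply/orP; left; apply/eqP; rewrite E; field.
by have := ler0n R n => n0; rewrite gt_eqF//; lra.
Qed.

Lemma cvg_euler_gamma : (harm n - ln n%:R : R) @[n --> \oo] --> euler_gamma R.
Proof.
suff : cvgn (fun n => harm n - ln n%:R : R) by [].
(* The shift is needed for monotonicity: as [ln 0 = 0], the original sequence starts with 0, 1 and
   decreases only from index 1 on. *)
apply/cvg_ex; pose u n := harm n.+1 - ln n.+1%:R : R.
have : cvgn u.
  apply: nonincreasing_is_cvgn.
    apply/nonincreasing_seqP => n; rewrite /u (harmS n.+1).
    have /andP[h _] := ln_succ_bounds n.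
    by rewrite -subr_ge0; move: h; rewrite -subr_ge0; congr (_ <= _); ring.
  exists 0 => _ [n _ <-].
  suff : ln n.+2%:R <= harm n.+1.
    rewrite subr_ge0; apply: le_trans.
    by rewrite ler_ln ?posrE// ler_nat.
  elim: n => [|n IH].
    have /andP[_] := ln_succ_bounds 0.
    by rewrite ln1 subr0 harmS /harm big_geq// add0r.
  have /andP[_ h] := ln_succ_bounds n.+1.
  by rewrite harmS (le_trans _ (lerD IH h))// addrC subrK.
by move=> /cvg_ex[l ul]; exists l; rewrite -cvg_shiftS.
Qed.

(** With [H] the harmonic sum, [odd_harmonicE] gives [H_(2n+1) - H_n / 2]. Subtracting the matching
    logarithms yields [gamma - gamma / 2], and the logarithms left over combine to [ln ((2n+1)/n)],
    the source of [ln 2]. *)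
Lemma cvg_odd_harmonic :
  (odd_harmonic n - 2^-1 * ln n%:R : R) @[n --> \oo] --> 2^-1 * euler_gamma R + ln 2.
Proof.
rewrite -cvg_shiftS.
have E n : odd_harmonic n.+1 - 2^-1 * ln n.+1%:R =
   (harm n.+1.*2.+1 - ln n.+1.*2.+1%:R) - 2^-1 * (harm n.+1 - ln n.+1%:R)
   + ln (2 + n.+1%:R^-1) :> R.
  have -> : 2 + n.+1%:R^-1 = n.+1.*2.+1%:R / n.+1%:R :> R.
    rewrite -[in RHS]natr1 -muln2 natrM; field.
    by have := ler0n R n => n0; rewrite gt_eqF//; lra.
  by rewrite odd_harmonicE ln_div ?posrE//; field.
rewrite [X in X @ _](_ : _ = (fun n => (harm n.+1.*2.+1 - ln n.+1.*2.+1%:R) -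
   2^-1 * (harm n.+1 - ln n.+1%:R) + ln (2 + n.+1%:R^-1))); last exact/funext.
have -> : 2^-1 * euler_gamma R + ln 2 = euler_gamma R - 2^-1 * euler_gamma R + ln (2 + 0) :> R.
  by rewrite addr0; field.
apply: cvgD; first apply: cvgB.
- apply: (cvg_comp (fun n => n.+1.*2.+1) (fun n => harm n - ln n%:R) _ cvg_euler_gamma).
  move=> A [N _ NA]; exists N => // n /= Nn; apply: NA => /=.
  by rewrite -addnn -addSn (leq_trans Nn)// (leq_trans (leqnSn n))// (leq_trans (leq_addr
    n.+1 _))// leqnSn.
- apply: cvgM; first exact: cvg_cst.
  by rewrite (cvg_shiftS (fun n => harm n - ln n%:R : R)); exact: cvg_euler_gamma.
- have c2 : {for (2 + 0 : R), continuous (@ln R)} by apply: continuous_ln; rewrite addr0.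
  apply: (cvg_comp (fun n => 2 + n.+1%:R^-1 : R) (@ln R) _ c2).
  apply: cvgD; first exact: cvg_cst.
  exact: cvg_harmonic.
Qed.

End Harmonic.

(** * From Wallis integrals to the logarithmic Gaussian integral *)

Section ErfIntegral.
Context {R : realType}.
Local Notation mu := (@lebesgue_measure R).

Lemma bernoulli_le (n : nat) (w : R) : 0 <= w <= 1 -> 1 - n%:R * w <= (1 - w) ^+ n.
Proof.
move=> /andP[w0 w1]; elim: n => [|n IH]; first by rewrite mul0r subr0 expr0.
rewrite exprS; have h : 0 <= 1 - w by rewrite subr_ge0.
apply: (le_trans _ (ler_wpM2l h IH)); rewrite -natr1 -subr_ge0.
rewrite (_ : _ - _ = n%:R * w ^+ 2); first by rewrite mulr_ge0// sqr_ge0.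
ring.
Qed.

(* [e^-z (1 + z) <= 1] gives [(1 - z)^n >= e^(-nz) (1 - z^2)^n], so Bernoulli's
   inequality bounds the error by [n z^2 e^(-nz)]. *)
Lemma expRN_pow_dist (n : nat) (z : R) : (0 < n)%N -> 0 <= z <= 1 ->
  `|expR (- (n%:R * z)) - (1 - z) ^+ n| <= 2 / n%:R.
Proof.
move=> n0 /andP[z0 z1].
have N0 : 0 < n%:R :> R by rewrite ltr0n.
have e1 : 1 - z <= expR (- z) by have := expR_ge1Dx (- z); rewrite addrC [- z + 1]addrC.
have z1' : 0 <= 1 - z by rewrite subr_ge0.
have en : expR (- (n%:R * z)) = expR (- z) ^+ n by rewrite -mulrN mulrC expRM_natr.
have lo : 0 <= expR (- (n%:R * z)) - (1 - z) ^+ n.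
  by rewrite en subr_ge0 lerXn2r// ?nnegrE// ?expR_ge0.
rewrite ger0_norm//.
have e2 : expR (- z) * (1 - z ^+ 2) <= 1 - z.
  have : expR (- z) * (1 + z) <= 1.
    by rewrite expRN mulrC ler_pdivrMr ?expR_gt0// mul1r expR_ge1Dx.
  move=> /(ler_wpM2r z1'); rewrite mul1r; apply: le_trans.
  by rewrite le_eqVlt; apply/orP; left; apply/eqP; ring.
have z21 : 0 <= z ^+ 2 <= 1 by rewrite sqr_ge0 expr_le1.
have e3 : expR (- (n%:R * z)) * (1 - n%:R * z ^+ 2) <= (1 - z) ^+ n.
  rewrite en; apply: (@le_trans _ _ ((expR (- z) * (1 - z ^+ 2)) ^+ n)).
    by rewrite exprMn ler_wpM2l ?exprn_ge0 ?expR_ge0// bernoulli_le.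
  rewrite lerXn2r// ?nnegrE// mulr_ge0 ?expR_ge0// subr_ge0; by case/andP: z21.
have e4 : expR (- (n%:R * z)) * (n%:R * z) ^+ 2 <= 2.
  rewrite expRN mulrC ler_pdivrMr ?expR_gt0//.
  have nz0 : 0 <= n%:R * z by rewrite mulr_ge0// ltW.
  have := @expR_ge1Dxn R (n%:R * z) 1 nz0; rewrite (_ : 2`! = 2%N)//.
  set x := (_ * _) ^+ 2; set e := expR _; lra.
rewrite ler_pdivlMr//; apply: le_trans e4.
apply: (@le_trans _ _ ((expR (- (n%:R * z)) * (n%:R * z ^+ 2)) * n%:R)).
  rewrite ler_wpM2r ?(ltW N0)//.
  set E := expR _ in e3 *; set P := (1 - z) ^+ n in e3 *; set y := _ * z ^+ 2 in e3 *.
  by move: e3; rewrite mulrBr mulr1; lra.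
by rewrite le_eqVlt; apply/orP; left; apply/eqP; ring.
Qed.

(** This is [(sqrt pi / 2) erf(u) / u] for [u != 0], in a form without singularity at 0. Accordingly
    [gauss_mean_int M] is [sqrt pi / 2] times the integral of [erf(v) / v] over [[0, M]]. *)
Definition gauss_mean (u : R) := \int[mu]_(q in `[0, 1]) expR (- (u * q) ^+ 2).

Lemma measurable_gauss_mean : measurable_fun setT gauss_mean.
Proof.
apply: (@measurable_Rintegral_param R `[0%R, 1%R] (fun u q => expR (- (u * q) ^+ 2))) => //.
apply: measurableT_comp => //; apply: measurableT_comp => //.
by apply: measurable_funX; apply: measurable_funM.
Qed.

Lemma integrable_gauss_scale (u a b : R) :
  mu.-integrable `[a, b] (EFin \o (fun q => expR (- (u * q) ^+ 2))).
Proof. by apply: continuous_itv_integrable => x _; exact: continuous_gauss_scale. Qed.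

Lemma gauss_mean_ge0 u : 0 <= gauss_mean u.
Proof. by apply: Rintegral_ge0 => x _; exact: expR_ge0. Qed.

Lemma gauss_mean_le1 u : gauss_mean u <= 1.
Proof.
have := @Rintegral_le_cst R 0 1 1 _ ler01 (integrable_gauss_scale u 0 1).
rewrite subr0 mulr1; apply => x _; exact: gauss_fun_le1.
Qed.

Lemma integrable_gauss_mean a b : mu.-integrable `[a, b] (EFin \o gauss_mean).
Proof.
apply: (@bounded_itv_integrable _ _ _ 1).
  by apply: measurable_funTS; exact: measurable_gauss_mean.
by move=> x _; rewrite ger0_norm ?gauss_mean_ge0// gauss_mean_le1.
Qed.

Lemma gauss_mean_bounds u : 0 < u ->
  Num.sqrt pi / 2 * u^-1 - u ^- 2 <= gauss_mean u <= Num.sqrt pi / 2 * u^-1.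
Proof.
move=> u0; have := gauss_itv_bounds u0 (@ltr01 R).
by rewrite mulr1 invfM mulrA.
Qed.

Definition gauss_mean_int (M : R) := \int[mu]_(u in `[0, M]) gauss_mean u.

(** Both sides of [gauss_mean_bounds] are integrated over [[M, M']]. The positive term [1/M'] is
    dropped from the lower bound, so that the error is uniform in [M'] and [M'] can go to
    infinity. *)
Lemma gauss_mean_int_diff M M' : 0 < M -> M <= M' ->
  Num.sqrt pi / 2 * (ln M' - ln M) - M^-1
   <= gauss_mean_int M' - gauss_mean_int M <= Num.sqrt pi / 2 * (ln M' - ln M).
Proof.
move=> M0 MM'.
have M'0 : 0 < M' by exact: lt_le_trans MM'.
rewrite /gauss_mean_int (Rintegral_itv_split (ltW M0) MM' (integrable_gauss_mean _ _))
  addrAC subrr add0r.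
set s := Num.sqrt pi / 2.
have xgt0 (x : R) : M <= x <= M' -> 0 < x by move=> /andP[Mx _]; exact: lt_le_trans Mx.
have c1 (x : R) : M <= x <= M' -> {for x, continuous (fun x : R => s * x^-1)}.
  move=> /xgt0 x0; apply: cvgM; first exact: cvg_cst.
  by apply: cvgV => //; rewrite gt_eqF.
have c2 (x : R) : M <= x <= M' -> {for x, continuous (fun x : R => s * x^-1 - x ^- 2)}.
  move=> xM; apply: cvgB; first exact: c1.
  apply: cvgV; last exact: exprn_continuous.
  by rewrite gt_eqF// exprn_gt0// xgt0.
have d1 (x : R) : M <= x <= M' -> is_derive x 1 (fun y : R => s * ln y) (s * x^-1).
  move=> /xgt0 x0; have h := is_derive_ptM (is_derive_ptc s x) (is_derive1_ln x0).
  by apply: (is_derive_eq h); rewrite mulr0 addr0.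
have d2 (x : R) : M <= x <= M' ->
    is_derive x 1 (fun y : R => s * ln y + y^-1) (s * x^-1 - x ^- 2).
  move=> xM; have x0 := xgt0 _ xM.
  have xn0 : id x != 0 by rewrite gt_eqF.
  have h := is_derive_ptD (d1 _ xM) (is_deriveV xn0 (is_derive_ptid x)).
  by apply: (is_derive_eq h); rewrite /GRing.scale/= mulr1.
have I1 : \int[mu]_(x in `[M, M']) (s * x^-1) = s * (ln M' - ln M).
  by rewrite (RFTC2_is_derive MM' d1)// mulrBr.
have I2 : \int[mu]_(x in `[M, M']) (s * x^-1 - x ^- 2) = s * (ln M' - ln M) + (M'^-1 - M^-1).
  by rewrite (RFTC2_is_derive MM' d2)//; ring.
apply/andP; split; last first.
  rewrite -I1; apply: le_Rintegral => //.
  - exact: integrable_gauss_mean.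
  - exact: continuous_itv_integrable.
  - move=> x /=; rewrite in_itv/= => /xgt0 x0.
    by case/andP: (gauss_mean_bounds x0).
apply: (@le_trans _ _ (s * (ln M' - ln M) + (M'^-1 - M^-1))).
  by rewrite lerD2l -subr_ge0 opprK subrK invr_ge0 ltW.
rewrite -I2; apply: le_Rintegral => //.
- exact: continuous_itv_integrable.
- exact: integrable_gauss_mean.
- move=> x /=; rewrite in_itv/= => /xgt0 x0.
  by case/andP: (gauss_mean_bounds x0).
Qed.



Lemma Rintegral_scale01 (c : R) (f : R -> R) :
  0 < c -> measurable_fun `[0, c] f -> (forall x, 0 <= x <= c -> 0 <= f x) ->
  \int[mu]_(x in `[0, c]) f x = c * \int[mu]_(y in `[0, 1]) f (c * y).
Proof.
move=> c0 mf f0; rewrite /Rintegral ge0_integral_scale01//.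
(* No integrability is assumed: if the integral is infinite, [fine] sends both sides to 0. *)
case: (\int[_]_(_ in _) _)%E => [r| |].
- by rewrite -EFinM.
- by rewrite gt0_muley//= mulr0.
- by rewrite gt0_muleNy//= mulr0.
Qed.

Lemma gauss_mean_wallis n (y : R) : (0 < n)%N -> 0 <= y <= 1 ->
  `|gauss_mean (Num.sqrt n%:R * y) - wallis_int n y| <= 2 / n%:R.
Proof.
move=> n0 /andP[y0 y1]; have -> : 2 / n%:R = 2 / n%:R * (1 - 0) :> R by rewrite subr0 mulr1.
apply: Rintegral_dist_le => //.
- exact: integrable_gauss_scale.
- by apply: continuous_itv_integrable => x _;
    exact: is_derive_continuous (is_derive_wallis n y x).
- move=> q /andP[q0 q1].
  rewrite -mulrA exprMn sqr_sqrtr ?ler0n//; apply: expRN_pow_dist => //.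
  by rewrite sqr_ge0 expr_le1 ?mulr_ge0// mulr_ile1.
Qed.

(** Rescaling [[0, sqrt n]] to [[0, 1]] multiplies the pointwise error [2/n] by [sqrt n], and the
    polynomial integral has the closed form [Rintegral_wallis_int]. *)
Lemma gauss_mean_int_wallis n : (0 < n)%N ->
  `|gauss_mean_int (Num.sqrt n%:R) - Num.sqrt n%:R * (wallis_int n 1 * odd_harmonic n)|
  <= 2 / Num.sqrt n%:R.
Proof.
move=> n0; set s := Num.sqrt n%:R.
have s0 : 0 < s by rewrite sqrtr_gt0 ltr0n.
have ss : s * s = n%:R by rewrite -expr2 sqr_sqrtr// ler0n.
rewrite /gauss_mean_int Rintegral_scale01//; last 2 first.
- by apply: measurable_funTS; exact: measurable_gauss_mean.
- by move=> x _; exact: gauss_mean_ge0.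
rewrite -mulrBr normrM gtr0_norm// -Rintegral_wallis_int.
have -> : 2 / s = s * (2 / n%:R * (1 - 0)).
  by rewrite -ss; field; rewrite gt_eqF.
rewrite ler_pM2l//; apply: Rintegral_dist_le => //.
- apply: (@bounded_itv_integrable _ _ _ 1).
    apply: measurable_funTS; apply: measurableT_comp; first exact: measurable_gauss_mean.
    exact: measurable_funM.
  by move=> x _; rewrite ger0_norm ?gauss_mean_ge0// gauss_mean_le1.
- by apply: continuous_itv_integrable => x _; exact: continuous_wallis_int.
- by move=> x x01; apply: gauss_mean_wallis.
Qed.

(** Wallis's formula with a rate. At [u = sqrt n] the Gaussian tail contributes [1/n] and the
    polynomial replacement [2/n]; multiplied by [sqrt n] they add up to the 3. *)
Lemma wallis_int1_asymp n : (0 < n)%N ->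
  `|Num.sqrt n%:R * wallis_int n 1 - Num.sqrt pi / 2| <= 3 / Num.sqrt n%:R :> R.
Proof.
move=> n0; have := @gauss_mean_wallis n 1 n0; rewrite ler01 lexx => /(_ isT).
rewrite mulr1; set s := Num.sqrt n%:R.
have s0 : 0 < s by rewrite sqrtr_gt0 ltr0n.
have ss : s * s = n%:R by rewrite -expr2 sqr_sqrtr// ler0n.
have /andP[] := gauss_mean_bounds s0.
rewrite -ss -expr2; set g := gauss_mean s; set w := wallis_int n 1; set p := _ / 2.
move=> h1 h2; rewrite !ler_norml => /andP[h3 h4].
have i2 : s ^- 2 = s^-1 * s^-1 by rewrite expr2 invfM.
have si : s * s^-1 = 1 by rewrite mulfV ?gt_eqF.
have E1 : 3 / s = s * (3 * s ^- 2) by rewrite i2; field; rewrite gt_eqF.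
have E2 : s * w - p = s * (w - p * s^-1) by rewrite mulrBr mulrCA si mulr1.
rewrite E1 E2 -mulrN !ler_pM2l//.
by apply/andP; split; lra.
Qed.

Lemma gauss_mean_int_sqrt n : (0 < n)%N ->
  `|gauss_mean_int (Num.sqrt n%:R) - Num.sqrt pi / 2 * odd_harmonic n|
  <= (3 * odd_harmonic n + 2) / Num.sqrt n%:R.
Proof.
move=> n0; have := gauss_mean_int_wallis n0; have := wallis_int1_asymp n0.
set s := Num.sqrt n%:R; set w := wallis_int n 1; set p := _ / 2; set S := odd_harmonic n;
  set L := gauss_mean_int s.
move=> h1 h2.
have S0 : 0 <= S by apply: sumr_ge0 => i _; rewrite invr_ge0.
have -> : L - p * S = (L - s * (w * S)) + (s * w - p) * S by ring.
apply: (le_trans (ler_normD _ _)); rewrite normrM (ger0_norm S0).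
have -> : (3 * S + 2) / s = 2 / s + 3 / s * S by ring.
by apply: lerD => //; rewrite ler_wpM2r.
Qed.

Let p : R := Num.sqrt pi / 2.
Let p0 : 0 < p. Proof. by rewrite divr_gt0// sqrtr_gt0 pi_gt0. Qed.

Lemma cvg_gauss_mean_int :
  (gauss_mean_int (Num.sqrt n.+1%:R) / p - ln (Num.sqrt n.+1%:R)) @[n --> \oo]
    --> 2^-1 * euler_gamma R + ln 2.
Proof.
pose sg n := odd_harmonic n.+1 - 2^-1 * ln n.+1%:R : R.
have csg : sg n @[n --> \oo] --> 2^-1 * euler_gamma R + ln 2.
  rewrite (cvg_shiftS (fun n => odd_harmonic n - 2^-1 * ln n%:R : R)); exact: cvg_odd_harmonic.
(* The error of [gauss_mean_int_sqrt] is of order [n^(-1/2) ln n]. With [r = (n+1)^(-1/4)], one of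
   the two factors [r] absorbs the logarithm through [r ln(1/r) <= 1] and the other tends to 0.
   Since [odd_harmonic] is [sg + 2 ln(1/r)], the constant 8 in [e] below is [2 + 3 * 2]. *)
pose r n := Num.sqrt (Num.sqrt (n.+1%:R^-1)) : R.
have cr : r n @[n --> \oo] --> (0 : R).
  have c0 : {for (0 : R), continuous (fun x : R => Num.sqrt (Num.sqrt x))}.
    apply: (@continuous_comp _ _ _ (@Num.sqrt R) (@Num.sqrt R)); exact: sqrt_continuous.
  have := cvg_comp _ _ (@cvg_harmonic R) c0.
  by rewrite sqrtr0 sqrtr0.
pose e n := (3 * `|sg n| + 8) * r n / p.
have ce : e n @[n --> \oo] --> (0 : R).
  have -> : 0 = (3 * `|2^-1 * euler_gamma R + ln 2| + 8) * 0 / p :> R by rewrite mulr0 mul0r.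
  apply: cvgM; last exact: cvg_cst.
  apply: cvgM => //; apply: cvgD; last exact: cvg_cst.
  by apply: cvgM; [exact: cvg_cst | exact: cvg_norm].
have cd : (gauss_mean_int (Num.sqrt n.+1%:R) / p - ln (Num.sqrt n.+1%:R) - sg n) @[n -->
  \oo] --> (0 : R).
  apply: norm_cvg0; apply: (squeeze_cvgr _ (cvg_cst 0) ce); near=> n.
  rewrite normr_ge0/=.
  have N0 : 0 < n.+1%:R :> R by [].
  have q0 : 0 < r n by rewrite !sqrtr_gt0 invr_gt0.
  have q1 : r n <= 1 by rewrite -[leRHS]sqrtr1 ler_wsqrtr// -[leRHS]sqrtr1 ler_wsqrtr//
    invf_le1// ler1n.
  have sE : (Num.sqrt n.+1%:R)^-1 = r n * r n.
    by rewrite -sqrtrV// -expr2 sqr_sqrtr// sqrtr_ge0.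
  have NE : n.+1%:R = (r n)^-1 ^+ 4 :> R.
    rewrite -[LHS]sqr_sqrtr// -[Num.sqrt _]invrK sE; field.
    by rewrite gt_eqF.
  have lnE : ln n.+1%:R = 4 * ln (r n)^-1 :> R.
    by rewrite NE lnXn ?invr_gt0// mulr_natl.
  have lsE : ln (Num.sqrt n.+1%:R) = 2^-1 * ln (n.+1%:R : R).
    by rewrite -powR12_sqrt// ln_powR.
  have lnr : ln (r n)^-1 <= (r n)^-1.
    by apply: (le_trans (ln_le_sub1 _)); rewrite ?invr_gt0// gerDl lerN10.
  have := gauss_mean_int_sqrt (ltn0Sn n); rewrite -/p sE.
  set L := gauss_mean_int _; set S := odd_harmonic _ => h.
  have -> : L / p - ln (Num.sqrt n.+1%:R) - sg n = (L - p * S) / p.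
    by rewrite /sg lsE -/S; field; rewrite gt_eqF.
  rewrite normrM normfV (gtr0_norm p0) ler_pM2r ?invr_gt0//.
  apply: (le_trans h); rewrite mulrA ler_pM2r//.
  have SE : S = sg n + 2 * ln (r n)^-1 by rewrite /sg -/S lnE; field.
  have a1 := ler_norm (sg n).
  have a2 : (3 * sg n + 2) * r n <= 3 * `|sg n| + 2.
    apply: (@le_trans _ _ ((3 * `|sg n| + 2) * r n)).
      by rewrite ler_pM2r//; lra.
    by rewrite ger_pMr// ltr_wpDl// mulr_ge0.
  have a3 : ln (r n)^-1 * r n <= 1 by rewrite -ler_pdivlMr// div1r.
  rewrite SE; set l := ln _ in a3 *.
  have -> : (3 * (sg n + 2 * l) + 2) * r n = (3 * sg n + 2) * r n + 6 * (l * r n) by ring.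
  lra.
rewrite (_ : (fun n => _) = (fun n => gauss_mean_int (Num.sqrt n.+1%:R) / p -
    ln (Num.sqrt n.+1%:R) - sg n + sg n)).
  by rewrite -[X in _ --> X]add0r; exact: cvgD.
by apply/funext => n; rewrite subrK.
Unshelve. all: by end_near.
Qed.

(** The limit along [sqrt n] suffices: [gauss_mean_int_diff] bounds the variation beyond [M] by
    [1/M] uniformly, and the bound passes to the limit. *)
Lemma gauss_mean_int_asymp M : 0 < M ->
  `|gauss_mean_int M / p - ln M - (2^-1 * euler_gamma R + ln 2)| <= p^-1 / M.
Proof.
move=> M0; rewrite distrC.
pose u n := `|gauss_mean_int (Num.sqrt n.+1%:R) / p - ln (Num.sqrt n.+1%:R) -
  (gauss_mean_int M / p - ln M)|.
have cu : u n @[n --> \oo] --> `|2^-1 * euler_gamma R + ln 2 - (gauss_mean_int M / p - ln M)|.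
  apply: cvg_norm; apply: cvgB; [exact: cvg_gauss_mean_int | exact: cvg_cst].
rewrite -(cvg_lim _ cu)//; apply: limr_le; first by apply/cvg_ex; eexists; exact: cu.
near=> n.
have Mn : M <= Num.sqrt n.+1%:R.
  rewrite -[leLHS](gtr0_norm M0) -sqrtr_sqr ler_wsqrtr//.
  near: n; exists (Num.bound (M ^+ 2)) => // n /= Hn.
  apply: (le_trans (ltW (archi_boundP (sqr_ge0 M)))).
  by rewrite ler_nat (leq_trans Hn).
have /andP[] := gauss_mean_int_diff M0 Mn; rewrite -/p /u.
set L' := gauss_mean_int _; set L := gauss_mean_int M; set l' := ln (Num.sqrt _) => h1 h2.
have -> : L' / p - l' - (L / p - ln M) = (L' - L - p * (l' - ln M)) / p.
  by field; rewrite gt_eqF.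
rewrite normrM normfV (gtr0_norm p0) mulrC ler_pM2l ?invr_gt0// ler_norml.
have Mi : 0 <= M^-1 by rewrite invr_ge0 ltW.
by apply/andP; split; lra.
Unshelve. all: by end_near.
Qed.

End ErfIntegral.

(** * The weight *)

Section PowerIntegrability.
Context {R : realType}.
Local Notation mu := (@lebesgue_measure R).

(** Monotone convergence along the segments [[1/(n+1), 1]], which exhaust []0, 1]]: on each, the
    antiderivative bounds the integral by [1/(c+1)]. *)
Lemma integrable_powR01 (c : R) : -1 < c ->
  mu.-integrable `[0, 1] (EFin \o (fun x => x `^ c)).
Proof.
move=> c1; have c10 : 0 < c + 1 by rewrite -ltrBlDr sub0r.
have mf (D : set R) : measurable_fun D (EFin \o (fun x : R => x `^ c)).
  by apply/measurable_EFinP; apply: measurable_funTS; exact: measurable_powR.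
apply/integrableP; split; first exact: mf.
under eq_integral do rewrite /= ger0_norm ?powR_ge0//.
rewrite -integral_itv_obnd_cbnd//.
pose F n := `[(n.+1%:R : R)^-1, 1]%classic.
have bF : \bigcup_n F n = `]0, 1]%classic.
  apply/seteqP; split => [x [n _]|x]; rewrite /F/= !in_itv/=.
    by move=> /andP[h ->]; rewrite andbT (lt_le_trans _ h).
  move=> /andP[x0 x1]; exists (Num.bound x^-1) => //; rewrite /F/= in_itv/= x1 andbT.
  rewrite invf_ple ?posrE//; apply: (le_trans (ltW (archi_boundP _))).
    by rewrite invr_ge0 ltW.
  by rewrite ler_nat.
rewrite -bF.
have cvF : (\int[mu]_(x in F n) (x `^ c)%:E)%E @[n --> \oo] -->
    (\int[mu]_(x in \bigcup_n F n) (x `^ c)%:E)%E.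
  apply: ge0_nondecreasing_set_cvg_integral => //.
  - move=> n m nm; apply/subsetPset; apply: subset_itv; rewrite bnd_simp//.
    by rewrite lef_pV2 ?posrE// ler_nat.
  - by move=> n; exact: measurable_itv.
  - by move=> n; exact: mf.
  - by move=> n x _; rewrite lee_fin powR_ge0.
apply: (@le_lt_trans _ _ ((c + 1)^-1)%:E); last exact: ltry.
rewrite -(cvg_lim _ cvF)//; apply: lime_le; first by apply/cvg_ex; eexists; exact: cvF.
near=> n.
have n1 : (n.+1%:R : R)^-1 <= 1 by rewrite invf_le1// ler1n.
have n0 : 0 < (n.+1%:R : R)^-1 by rewrite invr_gt0.
have xgt0 (x : R) : n.+1%:R^-1 <= x <= 1 -> 0 < x.
  by move=> /andP[nx _]; exact: lt_le_trans nx.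
have d (x : R) : n.+1%:R^-1 <= x <= 1 ->
    is_derive x 1 (fun x => x `^ (c + 1) / (c + 1)) (x `^ c).
  move=> /xgt0 x0.
  have h := is_derive_ptM (is_derive1_powR (c + 1) x0) (is_derive_ptc (c + 1)^-1 x).
  by apply: (is_derive_eq h); rewrite mulr0 add0r addrK mulrA mulVf ?mul1r// gt_eqF.
rewrite (FTC2_is_derive n1 d); last first.
  by move=> x /xgt0 x0; exact: is_derive_continuous (is_derive1_powR c x0).
by rewrite lee_fin powR1 div1r gerBl divr_ge0 ?powR_ge0// ltW.
Unshelve. all: by end_near.
Qed.

Lemma integrable_powR_onem (c : R) : -1 < c ->
  mu.-integrable `[0, 1] (EFin \o (fun x => (1 - x) `^ c)).
Proof.
move=> c1; have /integrableP[mf fi] := integrable_powR01 c1.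
apply/integrableP; split.
  apply/measurable_EFinP; apply: measurable_funTS.
  apply: (@measurableT_comp _ _ _ _ _ _ (@powR R ^~ c)) => //.
  exact: measurable_funB.
have n10 : (-1 : R) != 0 by rewrite oppr_eq0.
move: fi; rewrite integral_mkcond.
set f := (X in integral _ _ X) => fi.
have mf' : measurable_fun setT f.
  apply/(measurable_restrictT _ _).1; first exact: measurable_itv.
  by apply: measurableT_comp.
have f0 x : (0 <= f x)%E by rewrite /f patchE; case: ifPn => // _; rewrite abse_ge0.
move: fi; rewrite (ge0_integral_affine 1 n10 mf' f0) normrN1 mul1e => fi.
rewrite integral_mkcond; apply: le_lt_trans fi.
rewrite le_eqVlt; apply/orP; left; apply/eqP; apply: eq_integral => x _.
by rewrite /f !patchE !mem_setE !in_itv/= mulN1r [- x + 1]addrC gerBl subr_ge0 andbC.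
Qed.

End PowerIntegrability.

(** * The weight and its symmetrization *)

Section Weight.
Context {R : realType}.
Local Notation mu := (@lebesgue_measure R).

Definition weight (a q : R) := (1 - q) `^ (a - 1) / (1 + q) `^ a.
Definition sym_weight (a q : R) := weight a (- q) + weight a q.

Lemma weight_ge0 a q : 0 <= weight a q.
Proof. by rewrite divr_ge0// powR_ge0. Qed.

Lemma measurable_weight a : measurable_fun setT (weight a).
Proof.
apply: measurable_funM.
  apply: (@measurableT_comp _ _ _ _ _ _ (@powR R ^~ (a - 1))) => //.
  exact: measurable_funB.
apply: (@measurableT_comp _ _ _ _ _ _ (@GRing.inv R)); first exact: measurable_inv.
apply: (@measurableT_comp _ _ _ _ _ _ (@powR R ^~ a)) => //.
exact: measurable_funD.
Qed.

Lemma measurable_sym_weight a : measurable_fun setT (sym_weight a).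
Proof.
apply: measurable_funD; last exact: measurable_weight.
by apply: measurableT_comp; [exact: measurable_weight|].
Qed.

(** On [[0, 1]] the powers of [1 + q] are at most 1, leaving [(1-q)^(-a) + (1-q)^(a-1)]; both
    exponents exceed [-1] exactly because [0 < a < 1]. *)
Lemma integrable_sym_weight a : 0 < a < 1 ->
  mu.-integrable `[0, 1] (EFin \o sym_weight a).
Proof.
move=> /andP[a0 a1].
have i1 : mu.-integrable `[0, 1] (EFin \o (fun x => (1 - x) `^ (- a))).
  by apply: integrable_powR_onem; rewrite ltrN2.
have i2 : mu.-integrable `[0, 1] (EFin \o (fun x => (1 - x) `^ (a - 1))).
  by apply: integrable_powR_onem; rewrite ltrBrDr addNr.
have := integrableD _ i1 i2 => /(_ (measurable_itv _)).
apply: le_integrable => //.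
  by apply/measurable_EFinP; apply: measurable_funTS; exact: measurable_sym_weight.
move=> x /=; rewrite in_itv/= => /andP[x0 x1].
rewrite lee_fin !ger0_norm ?addr_ge0 ?weight_ge0 ?powR_ge0//.
have x1' : 1 <= 1 + x by rewrite lerDl.
apply: lerD; rewrite /weight.
- rewrite opprK -powRN -[leRHS]mul1r ler_wpM2r ?powR_ge0//.
  by rewrite -[leRHS](powRr0 (1 + x)) ler_powR// subr_le0 ltW.
- rewrite -[leRHS]mulr1 ler_wpM2l ?powR_ge0//.
  by rewrite -powRN -[leRHS](powRr0 (1 + x)) ler_powR// oppr_le0 ltW.
Qed.

(** Young's inequality with conjugate exponents [1/a] and [1/(1-a)]. *)
Lemma powR_weighted_am_gm (a x y : R) : 0 < a < 1 -> 0 < x -> 0 < y ->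
  x `^ a * y `^ (1 - a) <= a * x + (1 - a) * y.
Proof.
move=> /andP[a0 a1] x0 y0; have a1' : 0 < 1 - a by rewrite subr_gt0.
have := @conjugate_powR R (x `^ a) (y `^ (1 - a)) a^-1 (1 - a)^-1 (powR_ge0 _ _) (powR_ge0 _ _).
rewrite !invr_gt0 !invrK [a + _]addrC subrK => /(_ a0 a1' erefl).
rewrite -!powRrM !mulfV ?gt_eqF// !powRr1 ?(ltW x0) ?(ltW y0)//.
by rewrite [x * a]mulrC [y * (1 - a)]mulrC.
Qed.

(** Multiplied by [1 - q^2], each summand is a weighted geometric mean of [1 + q] and [1 - q]; the
    two arithmetic means add up to 2. For the lower bound, the product of the summands is
    [1/(1 - q^2) >= 1], so their sum is at least 2. The upper bound keeps [sym_weight] on the right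
    because [1/(1 - q^2)] is not integrable. *)
Lemma sym_weight_bounds a q : 0 < a < 1 -> 0 < q < 1 ->
  0 <= sym_weight a q - 2 <= q ^+ 2 * sym_weight a q.
Proof.
move=> a01 /andP[q0 q1]; have /andP[a0 a1] := a01.
have x0 : 0 < 1 + q by rewrite addr_gt0.
have y0 : 0 < 1 - q by rewrite subr_gt0.
have xn : 1 + q != 0 by rewrite gt_eqF.
have yn : 1 - q != 0 by rewrite gt_eqF.
set u := weight a (- q); set v := weight a q.
have uE : (1 + q) * (1 - q) * u = (1 + q) `^ a * (1 - q) `^ (1 - a).
  rewrite /u /weight opprK !powRB ?xn ?yn ?implybT// !powRr1 ?(ltW x0) ?(ltW y0)//.
  by field; rewrite xn gt_eqF// powR_gt0.
have vE : (1 + q) * (1 - q) * v = (1 - q) `^ a * (1 + q) `^ (1 - a).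
  rewrite /v /weight !powRB ?xn ?yn ?implybT// !powRr1 ?(ltW x0) ?(ltW y0)//.
  by field; rewrite yn gt_eqF// powR_gt0.
have uv : (1 + q) * (1 - q) * (u * v) = 1.
  rewrite /u /v /weight opprK !powRB ?xn ?yn ?implybT// !powRr1 ?(ltW x0) ?(ltW y0)//.
  by field; rewrite xn yn !gt_eqF// powR_gt0.
have u0 : 0 <= u by exact: weight_ge0.
have v0 : 0 <= v by exact: weight_ge0.
have hu := powR_weighted_am_gm a01 x0 y0; have hv := powR_weighted_am_gm a01 y0 x0.
rewrite -uE in hu; rewrite -vE in hv.
have -> : sym_weight a q = u + v by [].
apply/andP; split; last by lra.
rewrite subr_ge0 -ler_sqr ?nnegrE ?addr_ge0//.
have P1 : (1 + q) * (1 - q) <= 1.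
  by rewrite (_ : _ * _ = 1 - q ^+ 2); [rewrite gerBl sqr_ge0 | ring].
have uv1 : 1 <= u * v by rewrite -[leLHS]uv ler_piMl// mulr_ge0.
have -> : (u + v) ^+ 2 = (u - v) ^+ 2 + 4 * (u * v) by ring.
have -> : 2 ^+ 2 = 4 :> R by ring.
have := sqr_ge0 (u - v); set w := u * v in uv1 *; set z := _ ^+ 2; lra.
Qed.

Lemma integrable_sym_weight_div a : 0 < a < 1 ->
  mu.-integrable `[0, 1] (EFin \o (fun q => q^-1 * (sym_weight a q - 2))).
Proof.
move=> a01.
have i2 : mu.-integrable `[0, 1] (EFin \o (fun=> 2 : R)).
  by apply: continuous_itv_integrable => x _; exact: cvg_cst.
have := integrableD _ (integrable_sym_weight a01) i2 => /(_ (measurable_itv _)).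
apply: le_integrable => //.
  apply/measurable_EFinP; apply: measurable_funTS; apply: measurable_funM.
    exact: measurable_inv.
  by apply: measurable_funB => //; exact: measurable_sym_weight.
move=> x /=; rewrite in_itv/= => /andP[x0 x1].
have F0 : 0 <= sym_weight a x by rewrite addr_ge0// weight_ge0.
have B0 : 0 <= sym_weight a x + 2 by rewrite (le_trans F0)// lerDl.
rewrite lee_fin [leRHS](ger0_norm B0).
(* The end points lie outside the range of [sym_weight_bounds]; at 0 the integrand vanishes because
   [0^-1 = 0]. *)
have [E|xn0] := eqVneq x 0; first by rewrite {1}E invr0 mul0r normr0.
have [E|xn1] := eqVneq x 1.
  rewrite {1}E invr1 mul1r (le_trans (ler_normB _ _))// (ger0_norm F0).
  by rewrite ger0_norm.
have {}x0 : 0 < x by rewrite lt_neqAle eq_sym xn0.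
have {}x1 : x < 1 by rewrite lt_neqAle xn1.
have x01 : 0 < x < 1 by rewrite x0.
have /andP[h1 h2] := sym_weight_bounds a01 x01.
rewrite ger0_norm; last by rewrite mulr_ge0// invr_ge0 ltW.
rewrite mulrC ler_pdivrMr//; apply: (le_trans h2).
nra.
Qed.

(** With [r = sqrt(1 + q^2)], the chain rule gives [q / (r (1 + r))], which is the stated value
    because [q^2 = (r - 1)(r + 1)]. At [q = 0] both are 0 thanks to [0^-1 = 0]. *)
Lemma is_derive_ln_sqrt (q : R) :
  is_derive q 1 (fun q : R => ln (1 + Num.sqrt (1 + q ^+ 2)))
    (q^-1 * (1 - (Num.sqrt (1 + q ^+ 2))^-1)).
Proof.
have h0 : 0 < 1 + q ^+ 2 by rewrite ltr_wpDr// sqr_ge0.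
have r0 : 0 < Num.sqrt (1 + q ^+ 2) by rewrite sqrtr_gt0.
have s0 : 0 < 1 + Num.sqrt (1 + q ^+ 2) by rewrite addr_gt0.
have d1 := is_derive_ptD (is_derive_ptc 1 q) (is_derive_ptX 2 (is_derive_ptid q)).
have d2 := is_derive_ptcomp (f := fun y : R => 1 + y ^+ 2) (is_derive1_sqrt h0) d1.
have d3 := is_derive_ptcomp (f := fun y : R => 1 + Num.sqrt (1 + y ^+ 2)) (is_derive1_ln
  s0) (is_derive_ptD (is_derive_ptc 1 q) d2).
apply: (is_derive_eq d3).
have rr : Num.sqrt (1 + q ^+ 2) ^+ 2 = 1 + q ^+ 2 by rewrite sqr_sqrtr// ltW.
set r := Num.sqrt _ in r0 s0 rr *.
have [->|qn0] := eqVneq q 0.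
  by rewrite /= invr0 mul0r expr1 mulr0 mul0r addr0 mulr0 addr0 mulr0.
have q2 : q ^+ 2 = (r - 1) * (1 + r) by rewrite mulrBl mul1r mulrDr mulr1 -expr2 rr; ring.
rewrite /= expr1.
apply: (mulfI qn0); rewrite [RHS]mulrA mulfV// [RHS]mul1r.
transitivity (q ^+ 2 / ((1 + r) * r)).
  by field; rewrite !gt_eqF.
by rewrite q2; field; rewrite !gt_eqF.
Qed.

Lemma continuous_sqrt_div (q : R) :
  {for q, continuous (fun q : R => q^-1 * (1 - (Num.sqrt (1 + q ^+ 2))^-1))}.
Proof.
have E : (fun q : R => q^-1 * (1 - (Num.sqrt (1 + q ^+ 2))^-1)) =
   (fun q : R => q / (Num.sqrt (1 + q ^+ 2) * (1 + Num.sqrt (1 + q ^+ 2)))).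
  apply/funext => x.
  have h0 : 0 < 1 + x ^+ 2 by rewrite ltr_wpDr// sqr_ge0.
  have r0 : 0 < Num.sqrt (1 + x ^+ 2) by rewrite sqrtr_gt0.
  have s0 : 0 < 1 + Num.sqrt (1 + x ^+ 2) by rewrite addr_gt0.
  have rr : Num.sqrt (1 + x ^+ 2) ^+ 2 = 1 + x ^+ 2 by rewrite sqr_sqrtr// ltW.
  set r := Num.sqrt _ in r0 s0 rr *.
  have [->|qn0] := eqVneq x 0; first by rewrite invr0 !mul0r.
  have q2 : x ^+ 2 = (r - 1) * (1 + r) by rewrite mulrBl mul1r mulrDr mulr1 -expr2 rr; ring.
  apply: (mulfI qn0); rewrite [LHS]mulrA mulfV// mul1r mulrA -expr2 q2; field.
  by rewrite !gt_eqF.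
rewrite E.
have h0 : 0 < 1 + q ^+ 2 by rewrite ltr_wpDr// sqr_ge0.
have r0 : 0 < Num.sqrt (1 + q ^+ 2) by rewrite sqrtr_gt0.
have cs : {for q, continuous (fun q : R => Num.sqrt (1 + q ^+ 2))}.
  have d1 := is_derive_ptD (is_derive_ptc 1 q) (is_derive_ptX 2 (is_derive_ptid q)).
  exact: is_derive_continuous (is_derive_ptcomp (f := fun y : R => 1 + y ^+ 2)
    (is_derive1_sqrt h0) d1).
apply: cvgM; first exact: cvg_id.
apply: cvgV; first by rewrite gt_eqF// mulr_gt0// addr_gt0.
apply: cvgM => //; apply: cvgD => //; exact: cvg_cst.
Qed.

(** The antiderivative yields [ln(1 + sqrt 2) - ln 2]; the form with [sqrt 2 - 1] comes from
    [(sqrt 2 - 1)(sqrt 2 + 1) = 1]. *)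
Lemma Rintegral_sqrt_div :
  \int[mu]_(q in `[0, 1]) (q^-1 * (1 - (Num.sqrt (1 + q ^+ 2))^-1)) =
  - ln (Num.sqrt 2 - 1) - ln 2.
Proof.
rewrite (RFTC2_is_derive ler01 (fun x _ => is_derive_ln_sqrt x)); last first.
  by move=> x _; exact: continuous_sqrt_div.
rewrite expr1n expr0n/= addr0 sqrtr1 -[1 + 1]/(2 : R).
have s1 : 1 < Num.sqrt 2 :> R by rewrite -[ltLHS]sqrtr1 ltr_sqrt// ltr1n.
congr (_ - _); rewrite -lnV ?posrE ?subr_gt0//; congr ln.
have h : Num.sqrt 2 - 1 != 0 :> R by rewrite subr_eq0 gt_eqF.
apply: (mulfI h); rewrite mulfV//.
have ss : Num.sqrt 2 ^+ 2 = 2 :> R by rewrite sqr_sqrtr.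
by rewrite -[RHS](addrK 1) -[1 + 1]/(2 : R) -[in RHS]ss; ring.
Qed.

Lemma Rintegral_sym_weight a : 0 < a < 1 ->
  2^-1 * \int[mu]_(q in `[0, 1])
    (q^-1 * (sym_weight a q - 2 / Num.sqrt (1 + q ^+ 2))) =
  2^-1 * \int[mu]_(q in `[0, 1]) (q^-1 * (sym_weight a q - 2))
   - ln (Num.sqrt 2 - 1) - ln 2.
Proof.
move=> a01.
rewrite (_ : \int[mu]_(q in _) (q^-1 * (sym_weight a q - 2 / _)) =
  \int[mu]_(q in `[0, 1]) (q^-1 * (sym_weight a q - 2)) +
  2 * \int[mu]_(q in `[0, 1]) (q^-1 * (1 - (Num.sqrt (1 + q ^+ 2))^-1))).
  by rewrite Rintegral_sqrt_div; field.
have ii : mu.-integrable `[0, 1] (EFin \o (fun q : R => q^-1 * (1 - (Num.sqrt (1 + q ^+ 2))^-1))).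
  by apply: continuous_itv_integrable => x _; exact: continuous_sqrt_div.
rewrite -RintegralZl// -RintegralD//; last 2 first.
- exact: integrable_sym_weight_div.
- by apply: (integrableZl _ _ ii).
by apply: eq_Rintegral => q _; ring.
Qed.

End Weight.

(** * Cut-off functions *)

Section Cutoff.
Context {R : realType}.
Implicit Types Xi Y : R -> R.

(** Here [d] is the length of the plateau at height 1. The Lipschitz condition is restricted to
    positive arguments, since the function jumps from 0 to 1 at the origin. *)
Definition lipschitz_bump (d L : R) Y :=
  [/\ measurable_fun setT Y, (forall x, 0 <= Y x <= 1),
    (forall x, 0 < x < d -> Y x = 1),
    (forall x, x <= 0 \/ 2^-1 <= x -> Y x = 0) &
    (forall x y, 0 < x -> 0 < y -> `|Y x - Y y| <= L * `|x - y|)].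

Lemma bounded_derivative_lipschitz (f : R -> R) (a b : R) : a <= b ->
  (forall x, a <= x <= b -> derivable f x 1) ->
  (forall x, a <= x <= b -> {for x, continuous (derive1 f)}) ->
  exists2 L, 0 <= L & forall x y, a <= x <= b -> a <= y <= b ->
    `|f x - f y| <= L * `|x - y|.
Proof.
move=> ab df cdf.
have cn : {within `[a, b], continuous (fun x => `|(derive1 f) x|)}.
  apply: within_continuous => x /=; rewrite in_itv/= => xab.
  by apply: cvg_norm; exact: cdf.
have [c cab cmax] := EVT_max ab cn.
exists `|(derive1 f) c|; first exact: normr_ge0.
have key (x y : R) : a <= x <= b -> a <= y <= b -> x <= y -> `|f x - f y| <= `|(derive1 f)
  c| * `|x - y|.
  move=> /andP[ax xb] /andP[ay yb] xy.
  have d (z : R) : z \in `]x, y[ -> is_derive z 1 f ((derive1 f) z).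
    rewrite in_itv/= => /andP[xz zy]; rewrite derive1E; apply: derivableP.
    by apply: df; rewrite (le_trans ax (ltW xz)) (le_trans (ltW zy) yb).
  have cf : {within `[x, y], continuous f}.
    apply: within_continuous => z /=; rewrite in_itv/= => /andP[xz zy].
    apply/differentiable_continuous/derivable1_diffP; apply: df.
    by rewrite (le_trans ax xz) (le_trans zy yb).
  have [z] := MVT_segment xy d cf; rewrite in_itv/= => /andP[xz zy] E.
  rewrite distrC E normrM distrC; apply: ler_wpM2r => //; apply: cmax.
  by rewrite in_itv/= (le_trans ax xz) (le_trans zy yb).
move=> x y hx hy; have [xy|yx] := leP x y; first exact: key.
by rewrite distrC [X in _ * X]distrC; apply: key => //; exact: ltW.
Qed.

(** Extension by 0, because [cutoff] says nothing outside [[0, 1]] while the substitutions below act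
    on the whole line. *)
Definition cutoff01 Xi : R -> R := Xi \_ `]0, 1[.

Lemma cutoff01E Xi x : cutoff01 Xi x = if 0 < x < 1 then Xi x else 0.
Proof. by rewrite /cutoff01 patchE mem_setE in_itv. Qed.

Lemma cutoff01_bump Xi : cutoff Xi -> exists d L : R,
  [/\ 0 < d, d < 2^-1, 0 <= L & lipschitz_bump d L (cutoff01 Xi)].
Proof.
move=> [dX mX nX [U [oU UI] UX]].
have [e e0 eX] : exists2 e : R, 0 < e & forall x, 0 < x < e -> Xi x = 1.
  have [e /= e0 eX] := nX; exists (Num.min e 1); first by rewrite lt_min e0 ltr01.
  move=> x /andP[x0]; rewrite lt_min => /andP[xe x1]; apply: eX; last by rewrite !ltW.
  by rewrite /= sub0r normrN gtr0_norm.
have X0 (x : R) : 2^-1 <= x <= 1 -> Xi x = 0.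
  move=> /andP[hx x1]; apply: UX; last by rewrite x1 andbT (le_trans _ hx).
  by apply: UI; rewrite /= in_itv/= hx.
pose d := Num.min e (4^-1) : R.
have d0 : 0 < d by rewrite lt_min e0/=.
have d4 : d <= 4^-1 by rewrite ge_min lexx orbT.
have dX1 (x : R) : 0 < x < d -> Xi x = 1.
  by move=> /andP[x0]; rewrite lt_min => /andP[xe _]; apply: eX; rewrite x0.
(* Derivatives are controlled only inside []0, 1[], so a Lipschitz constant is taken on a compact
   [[c, c']] with [c] in the plateau and [c'] in the zero region. *)
pose c := d / 2; pose c' := 3 / 4 : R.
have c0 : 0 < c by rewrite divr_gt0.
have cd : c < d by rewrite /c; lra.
have cc' : c <= c' by rewrite /c /c'; lra.
have c'1 : c' < 1 by rewrite /c'; lra.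
have in01 (x : R) : c <= x <= c' -> 0 < x < 1.
  by move=> /andP[cx xc]; rewrite (lt_le_trans c0 cx) (le_lt_trans xc c'1).
have [L L0 HL] : exists2 L, 0 <= L & forall x y, c <= x <= c' -> c <= y <= c' ->
    `|Xi x - Xi y| <= L * `|x - y|.
  apply: bounded_derivative_lipschitz => //.
    by move=> x /in01 /(dX 0).
  move=> x /in01 /(dX 1); rewrite derive1n1 => h.
  exact/differentiable_continuous/derivable1_diffP.
exists d, L; split => //; first by lra.
(* For [x > 0] the extended cut-off is [Xi] after clamping to [[c, c']]. Clamping is monotone and
   1-Lipschitz, which transfers both measurability and the Lipschitz bound. *)
pose cl (x : R) := Num.max c (Num.min x c').
have clE (x : R) : 0 < x -> cutoff01 Xi x = Xi (cl x).
  move=> x0; rewrite cutoff01E x0 /cl /=.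
  have [xc|cx] := ltP x c.
    have -> : Num.min x c' = x by apply/min_idPl; lra.
    have -> : Num.max c x = c by apply/max_idPl; lra.
    rewrite !dX1 ?c0 ?x0//=; last lra.
    by rewrite ifT//; lra.
  have [xc'|c'x] := leP x c'.
    have -> : Num.max c x = x by apply/max_idPr.
    by rewrite ifT//; lra.
  have -> : Num.max c c' = c' by apply/max_idPr.
  rewrite (X0 c'); last by rewrite /c'; lra.
  case: ifP => // x1; apply: X0; rewrite (ltW x1) andbT; move: c'x; rewrite /c'; lra.
have clin (x : R) : c <= cl x <= c'.
  by rewrite /cl le_max lexx/= ge_max cc'/= ge_min lexx orbT.
have clm (x y : R) : x <= y -> 0 <= cl y - cl x <= y - x.
  rewrite /cl; case: (leP x c') => h1; case: (leP y c') => h2;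
  [case: (leP c x) => h3; case: (leP c y) => h4
  | case: (leP c x) => h3; case: (leP c c') => h4
  | case: (leP c c') => h3; case: (leP c y) => h4
  | case: (leP c c') => h3 ]; lra.
have cl1 (x y : R) : `|cl x - cl y| <= `|x - y|.
  have [xy|/ltW xy] := leP x y.
    rewrite distrC [leRHS]distrC; have /andP[h1 h2] := clm _ _ xy.
    by rewrite !ger0_norm// subr_ge0.
  have /andP[h1 h2] := clm _ _ xy.
  by rewrite !ger0_norm// subr_ge0.
have X01 (x : R) : 0 < x < 1 -> 0 <= Xi x <= 1.
  move=> /andP[x0 x1]; apply/andP; split.
    by rewrite -(X0 1) ?lexx ?andbT ?invf_le1 ?ler1n//; apply: mX => //; exact: ltW.
  have [xd|dx] := ltP x d; first by rewrite dX1 ?x0.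
  rewrite -(dX1 c) ?c0//; apply: mX; lra.
have cl01 (x : R) : 0 <= cl x <= 1.
  by have /andP[h1 h2] := clin x; rewrite (le_trans (ltW c0) h1) (le_trans h2 (ltW c'1)).
have cut0 (x : R) : x <= 0 -> cutoff01 Xi x = 0.
  by move=> x0; rewrite cutoff01E ltNge x0.
split.
- rewrite (_ : cutoff01 Xi = (Xi \o cl) \_ `]0, +oo[).
    apply/(measurable_restrictT _ _).1; first exact: measurable_itv.
    apply: nonincreasing_measurable => // x y xy.
    have /andP[y0 y1] := cl01 y; have /andP[x0 x1] := cl01 x.
    apply: mX => //; rewrite -subr_ge0; by have /andP[] := clm _ _ xy.
  apply/funext => x; rewrite patchE mem_setE in_itv/= andbT.
  by case: ifP => [/clE//|/negbT]; rewrite -leNgt => /cut0.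
- by move=> x; rewrite cutoff01E; case: ifP => [/X01//|_]; rewrite lexx ler01.
- move=> x /andP[x0 xd]; rewrite cutoff01E x0/= ifT; first by rewrite dX1 ?x0.
  by lra.
- move=> x [/cut0//|hx]; rewrite cutoff01E; case: ifP => // /andP[_ x1]; apply: X0.
  by rewrite hx ltW.
- move=> x y x0 y0; rewrite !clE//; apply: (le_trans (HL _ _ (clin x) (clin y))).
  by rewrite ler_wpM2l.
Qed.

End Cutoff.

(** * Reduction to one variable *)

Section Hyperbolic.
Context {R : realType}.
Local Notation mu := (@lebesgue_measure R).

Lemma ge0_integral_affine_EFin (c d : R) (g : R -> R) :
  c != 0 -> measurable_fun setT g -> (forall x, 0 <= g x) ->
  (\int[mu]_x (g x)%:E = \int[mu]_x (`|c| * g (c * x + d)%R)%:E)%E.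
Proof.
move=> c0 mg g0; rewrite (ge0_integral_affine d c0); last 2 first.
- exact/measurable_EFinP.
- by move=> x; rewrite lee_fin.
rewrite -ge0_integralZl_EFin//.
- by move=> x _; rewrite lee_fin.
- apply/measurable_EFinP; apply: (@measurableT_comp _ _ _ _ _ _ g) => //.
  exact: measurable_affine.
Qed.

Lemma measurable_fun2_comp (f : R -> R -> R) (u v : R * R -> R) :
  measurable_fun setT (fun z : R * R => f z.1 z.2) ->
  measurable_fun setT u -> measurable_fun setT v ->
  measurable_fun setT (fun z => f (u z) (v z)).
Proof.
move=> mf mu_ mv.
have mp : measurable_fun setT (fun z => (u z, v z)) by exact: measurable_fun_pair.
by have := measurableT_comp mf mp.
Qed.

(* The substitution [x = s (1 + q)], [y = s (1 - q)], whose Jacobian is [2 s],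
   as two affine substitutions. *)
Lemma integral_hyperbolic (f : R -> R -> R) :
  measurable_fun setT (fun z : R * R => f z.1 z.2) ->
  (forall x y, 0 <= f x y) -> (forall x y, x <= 0 \/ y <= 0 -> f x y = 0) ->
  (\int[mu]_y \int[mu]_x (f x y)%:E =
   \int[mu]_q \int[mu]_s
     (\1_(`]0%R, +oo[ : set R) s * (2 * s * f (s * (1 + q)) (s * (1 - q))))%:E)%E.
Proof.
move=> mf f0 fz.
have m1 : measurable_fun setT (fun z : R * R => z.1) by exact: measurable_fst.
have m2 : measurable_fun setT (fun z : R * R => z.2) by exact: measurable_snd.
rewrite -(@fubini_tonelli _ _ _ _ R mu mu (fun z => (f z.1 z.2)%:E)); last 2 first.
- exact/measurable_EFinP.
- by move=> x; rewrite lee_fin.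
transitivity (\int[mu]_x \int[mu]_s (2 * f x (2 * s - x)%R)%:E)%E.
  apply: eq_integral => x _ /=.
  rewrite (ge0_integral_affine_EFin (- x) (_ : (2 : R) != 0))//; last first.
    by have := @measurable_fun_pair2 _ _ _ _ _ _ _ x mf.
  by rewrite ger0_norm.
rewrite (@fubini_tonelli _ _ _ _ R mu mu (fun z => (2 * f z.1 (2 * z.2 - z.1)%R)%:E));
  last 2 first.
- apply/measurable_EFinP; apply: measurable_funM => //.
  apply: measurable_fun2_comp => //; apply: measurable_funB => //.
  exact: measurable_funM.
- by move=> z; rewrite lee_fin mulr_ge0.
rewrite -[RHS](@fubini_tonelli _ _ _ _ R mu mu (fun z => (\1_(`]0%R, +oo[ : set R) z.1 *
   (2 * z.1 * f (z.1 * (1 + z.2)) (z.1 * (1 - z.2))))%:E)); last 2 first.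
- apply/measurable_EFinP; apply: measurable_funM.
    by apply: (@measurableT_comp _ _ _ _ _ _ (\1_(`]0%R, +oo[ : set R) : R -> R)).
  apply: measurable_funM; first exact: measurable_funM.
  apply: measurable_fun2_comp => //; apply: measurable_funM => //.
    exact: measurable_funD.
  exact: measurable_funB.
- move=> z; rewrite lee_fin indicE mem_setE in_itv/= andbT.
  by case: ltP => [z0|_]; rewrite ?mul0r// mul1r !mulr_ge0// ltW.
apply: eq_integral => s _ /=.
rewrite indicE mem_setE in_itv/= andbT; case: ltP => [s0|s0]; last first.
  rewrite [RHS]integral0_eq; last by move=> q _; rewrite mul0r.
  rewrite [LHS]integral0_eq// => x _.
  rewrite fz ?mulr0//; have [x0|x0] := leP x 0; [by left | by right; lra].
rewrite (ge0_integral_affine_EFin s (_ : s != 0)); last 3 first.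
- by rewrite gt_eqF.
- apply: measurable_funM => //.
  have m3 : measurable_fun setT (fun z : R * R => 2 * z.2 - z.1).
    by apply: measurable_funB => //; exact: measurable_funM.
  by have := @measurable_fun_pair1 _ _ _ _ _ _ _ s (measurable_fun2_comp mf m1 m3).
- by move=> x; rewrite mulr_ge0.
apply: eq_integral => q _; rewrite gtr0_norm// mul1r; congr (_ %:E).
by rewrite mulrA [s * 2]mulrC; congr (_ * f _ _); ring.
Qed.

End Hyperbolic.

(** * The heat content as an integral of slices *)

Section HeatSlices.
Context {R : realType}.
Local Notation mu := (@lebesgue_measure R).
Variables (a b t : R) (Y1 Y2 : R -> R) (d1 d2 L1 L2 : R).
Hypotheses (a01 : 0 < a < 1) (ab1 : a + b = 1) (t0 : 0 < t).
Hypotheses (bY1 : lipschitz_bump d1 L1 Y1) (bY2 : lipschitz_bump d2 L2 Y2).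

Definition heat_density (x y : R) : R :=
  heat_kernel x y t * (x `^ (- a) * Y1 x) * (y `^ (- b) * Y2 y).

(** What remains of the integrand in [s] once the weight in [q] is factored out: since
    [x - y = 2 s q], the kernel is a Gaussian in [s] of rate [q / sqrt t], and
    [s s^(-a) s^(-b) = 1]. *)
Definition slice (q s : R) : R :=
  (Num.sqrt (pi * t))^-1 * expR (- (q / Num.sqrt t * s) ^+ 2) *
  (Y1 (s * (1 + q)) * Y2 (s * (1 - q))).

Definition slice_int (q : R) : R := \int[mu]_(s in `[0, 2^-1]) slice q s.

Let Y1_01 x : 0 <= Y1 x <= 1. Proof. by case: bY1. Qed.
Let Y2_01 x : 0 <= Y2 x <= 1. Proof. by case: bY2. Qed.
Let Y1z x : x <= 0 \/ 2^-1 <= x -> Y1 x = 0. Proof. by case: bY1 => _ _ _ h _; apply: h. Qed.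
Let Y2z x : x <= 0 \/ 2^-1 <= x -> Y2 x = 0. Proof. by case: bY2 => _ _ _ h _; apply: h. Qed.
Let mY1 : measurable_fun setT Y1. Proof. by case: bY1. Qed.
Let mY2 : measurable_fun setT Y2. Proof. by case: bY2. Qed.

Lemma heat_kernel_ge0 x y : 0 <= heat_kernel x y t.
Proof. by rewrite mulr_ge0// ?expR_ge0// invr_ge0 sqrtr_ge0. Qed.

Lemma heat_kernel_hyperbolic q s :
  2 * heat_kernel (s * (1 + q)) (s * (1 - q)) t =
  (Num.sqrt (pi * t))^-1 * expR (- (q / Num.sqrt t * s) ^+ 2).
Proof.
have st : Num.sqrt t ^+ 2 = t by rewrite sqr_sqrtr// ltW.
have s4 : Num.sqrt (4 * pi * t) = 2 * Num.sqrt (pi * t).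
  by rewrite -mulrA sqrtrM// (_ : 4 = 2 ^+ 2) ?sqrtr_sqr ?ger0_norm//; ring.
rewrite /heat_kernel s4 invfM mulrA mulrA divff// mul1r; congr (_ * expR _).
rewrite (_ : s * (1 + q) - s * (1 - q) = 2 * (s * q)); last by ring.
rewrite (_ : (q / Num.sqrt t * s) ^+ 2 = (s * q) ^+ 2 / t); last first.
  by rewrite -[in RHS]st; field; rewrite gt_eqF// sqrtr_gt0.
by field; rewrite gt_eqF.
Qed.

(** The supports fix the domain: if [|q| >= 1], one of [s (1 + q)], [s (1 - q)] is nonpositive, and
    if [s > 1/2], one of them is at least [1/2]; in either case a cut-off vanishes. *)
Lemma heat_density_hyperbolic q s :
  \1_(`]0%R, +oo[ : set R) s * (2 * s * heat_density (s * (1 + q)) (s * (1 - q))) =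
  \1_(`[0%R, 2^-1] : set R) s * (\1_(`](-1)%R, 1%R[ : set R) q * weight a q * slice q s).
Proof.
rewrite !indicE !mem_setE !in_itv/= andbT.
have [s0|s0] := ltP 0 s; last first.
  rewrite mul0r; have [s0'|] := leP 0 s; last by rewrite mul0r.
  have -> : s = 0 by apply/le_anti; rewrite s0 s0'.
  by rewrite /slice !mul0r Y1z ?mul0r ?mulr0//; left.
rewrite (ltW s0)/= mul1r.
have q1 : 1 <= q -> heat_density (s * (1 + q)) (s * (1 - q)) = 0.
  move=> h; rewrite /heat_density Y2z ?mulr0//; left.
  by rewrite pmulr_rle0// subr_le0.
have qN1 : q <= -1 -> heat_density (s * (1 + q)) (s * (1 - q)) = 0.
  move=> h; rewrite /heat_density Y1z ?mulr0 ?mul0r//; left.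
  by rewrite pmulr_rle0//; lra.
have [qN|/qN1 ->] := ltP (-1) q; last by rewrite /= ?(mul0r, mulr0).
have [q1'|/q1 ->] := ltP q 1; last by rewrite /= ?(mul0r, mulr0).
rewrite mul1r.
have [s2|s2] := leP s 2^-1; last first.
  rewrite mul0r /heat_density.
  have [q0|q0] := leP 0 q.
    by rewrite Y1z ?mulr0 ?mul0r ?mulr0//; right; nra.
  by rewrite Y2z ?mulr0//; right; nra.
rewrite mul1r /heat_density /slice -heat_kernel_hyperbolic.
set K := heat_kernel _ _ _; set A := Y1 _; set B := Y2 _.
have x0 : 0 <= 1 + q by rewrite -lerBlDl sub0r ltW.
have y0 : 0 <= 1 - q by rewrite subr_ge0 ltW.
have s0' := ltW s0.
rewrite !powRM// (powRN (1 + q) a).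
have -> : - b = a - 1 by rewrite -ab1 opprD addrA subrr sub0r.
have ss : s * s `^ (- a) * s `^ (a - 1) = 1.
  rewrite -mulrA -powRD; last by rewrite (gt_eqF s0) implybT.
  rewrite (_ : - a + (a - 1) = -1); last by ring.
  by rewrite powR_inv1// mulfV// gt_eqF.
rewrite /weight; set w1 := (1 - q) `^ _; set w2 := (_ `^ _)^-1.
transitivity ((s * s `^ (- a) * s `^ (a - 1)) * (2 * K * (w1 * w2) * (A * B))); first by ring.
by rewrite ss mul1r; ring.
Qed.

Lemma slice_bounds q s : 0 <= slice q s <= (Num.sqrt (pi * t))^-1.
Proof.
have c0 : 0 <= (Num.sqrt (pi * t))^-1 by rewrite invr_ge0 sqrtr_ge0.
have /andP[A0 A1] := Y1_01 (s * (1 + q)); have /andP[B0 B1] := Y2_01 (s * (1 - q)).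
rewrite /slice !mulr_ge0 ?expR_ge0//= -mulrA ler_piMr//.
rewrite mulr_ile1 ?expR_ge0 ?mulr_ge0 ?mulr_ile1//.
exact: gauss_fun_le1.
Qed.

Lemma measurable_slice : measurable_fun setT (fun z : R * R => slice z.1 z.2).
Proof.
have m1 : measurable_fun setT (fun z : R * R => z.1) by exact: measurable_fst.
have m2 : measurable_fun setT (fun z : R * R => z.2) by exact: measurable_snd.
apply: measurable_funM; first apply: measurable_funM => //.
  apply: measurableT_comp => //; apply: measurableT_comp => //.
  by apply: measurable_funX; apply: measurable_funM => //; apply: measurable_funM.
apply: measurable_funM; apply: measurableT_comp => //; apply: measurable_funM => //.
  exact: measurable_funD.
exact: measurable_funB.
Qed.

Lemma integrable_slice q : mu.-integrable `[0, 2^-1] (EFin \o slice q).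
Proof.
apply: (@bounded_itv_integrable _ _ _ (Num.sqrt (pi * t))^-1).
  by apply: measurable_funTS; have := @measurable_fun_pair2 _ _ _ _ _ _ _ q measurable_slice.
by move=> s _; have /andP[s0 s1] := slice_bounds q s; rewrite ger0_norm.
Qed.

Lemma measurable_slice_int : measurable_fun setT slice_int.
Proof.
apply: measurable_Rintegral_param => //; first exact: measurable_slice.
by move=> q s; case/andP: (slice_bounds q s).
Qed.

Lemma slice_int_ge0 q : 0 <= slice_int q.
Proof. by apply: Rintegral_ge0 => s _; case/andP: (slice_bounds q s). Qed.

Lemma measurable_heat_density :
  measurable_fun setT (fun z : R * R => heat_density z.1 z.2).
Proof.
have m1 : measurable_fun setT (fun z : R * R => z.1) by exact: measurable_fst.
have m2 : measurable_fun setT (fun z : R * R => z.2) by exact: measurable_snd.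
have mp (c : R) (Y : R -> R) : measurable_fun setT Y -> measurable_fun setT (fun x : R => x
  `^ c * Y x).
  by move=> mY; apply: measurable_funM => //; exact: measurable_powR.
apply: measurable_funM; first apply: measurable_funM.
- apply: measurable_funM => //; apply: measurableT_comp => //; apply: measurable_funM => //.
  by apply: measurableT_comp => //; apply: measurable_funX; apply: measurable_funB.
- exact: (measurableT_comp (mp (- a) Y1 mY1) m1).
- exact: (measurableT_comp (mp (- b) Y2 mY2) m2).
Qed.

Lemma heat_density_ge0 x y : 0 <= heat_density x y.
Proof.
have /andP[A0 _] := Y1_01 x; have /andP[B0 _] := Y2_01 y.
by rewrite /heat_density !mulr_ge0 ?heat_kernel_ge0 ?powR_ge0.
Qed.

Lemma integral_heat_density :
  (\int[mu]_y \int[mu]_x (heat_density x y)%:E =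
   \int[mu]_(q in `]0%R, 1%R[) (weight a q * slice_int q + weight a (- q) * slice_int (-
     q))%:E)%E.
Proof.
rewrite (integral_hyperbolic measurable_heat_density heat_density_ge0); last first.
  move=> x y [x0|y0]; rewrite /heat_density.
    by rewrite Y1z ?mulr0 ?mul0r//; left.
  by rewrite Y2z ?mulr0//; left.
pose W q := \1_(`](-1)%R, 1%R[ : set R) q * weight a q * slice_int q.
have W0 q : 0 <= W q.
  apply: mulr_ge0; last exact: slice_int_ge0.
  by apply: mulr_ge0; [rewrite indicE | exact: weight_ge0].
have mW : measurable_fun setT W.
  apply: measurable_funM; last exact: measurable_slice_int.
  apply: measurable_funM; last exact: measurable_weight.
  exact: measurable_indic.
have WE q : 0 < q < 1 -> W q = weight a q * slice_int q.
  move=> /andP[q0 q1]; rewrite /W indicE mem_setE in_itv/= q1 andbT.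
  by rewrite (lt_trans _ q0) ?ltrN10// mul1r.
have WNE q : 0 < q < 1 -> W (- q) = weight a (- q) * slice_int (- q).
  move=> /andP[q0 q1]; rewrite /W indicE mem_setE in_itv/= ltrN2 q1/=.
  by rewrite (lt_trans _ (@ltr01 R)) ?oppr_lt0// mul1r.
transitivity (\int[mu]_q (W q)%:E)%E.
  apply: eq_integral => q _.
  under eq_integral do rewrite heat_density_hyperbolic.
  transitivity (\int[mu]_(s in `[0%R, 2^-1%R]) (\1_(`](-1)%R, 1%R[ : set R) q * weight a q
    * slice q s)%:E)%E.
    rewrite [RHS]integral_mkcond; apply: eq_integral => s _.
    by rewrite epatch_indic/= muleC.
  rewrite /W /slice_int -RintegralZl//; last exact: integrable_slice.
  rewrite /Rintegral fineK//.
  apply: integrable_fin_num => //.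
  by apply: (integrableZl _ _ (integrable_slice q)).
have mWE D : measurable_fun D (EFin \o W).
  by apply/measurable_EFinP; exact: measurable_funTS.
have mWNE D : measurable_fun D (EFin \o (W \o -%R)).
  by apply/measurable_EFinP; apply: measurable_funTS; exact: measurableT_comp.
have W0E (q : R) : (0 <= (W q)%:E)%E by rewrite lee_fin.
rewrite -set_itvNyy (@itv_bndbnd_setU _ _ _ (BRight (0 : R)))//.
rewrite ge0_integral_setU//=; last 2 first.
- exact: mWE.
- apply/disj_setPRL => x /=; rewrite !in_itv/= andbT => x0; apply/negP; by rewrite -ltNge.
have -> : (\int[mu]_(x in `]-oo, 0%R]) (W x)%:E = \int[mu]_(x in `]0%R, +oo[) (W (- x)%R)%:E)%E.
  have := @ge0_integration_by_substitution0 R (fun q => (W (- q))%:E) (mWNE setT) (fun r =>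
    W0E _).
  rewrite -integral_itv_obnd_cbnd; last exact (mWNE _).
  by move=> ->; apply: eq_integral => x _; rewrite opprK.
have addE := @ge0_integralD _ _ _ mu _ (measurable_itv `]0%R, +oo[) _ _
  (fun q _ => W0E (- q)) (mWNE _) (fun q _ => W0E q) (mWE _).
rewrite -addE.
rewrite integral_mkcond [RHS]integral_mkcond; apply: eq_integral => q _.
rewrite !patchE !mem_setE !in_itv/= andbT; case: ltP => //= q0.
case: ltP => [q1|q1].
  have q01 : 0 < q < 1 by rewrite q0.
  by rewrite -EFinD (WE _ q01) (WNE _ q01) addrC.
rewrite /W !indicE !mem_setE !in_itv/= ltrN2 !(ltNge _ 1) q1/= andbF !mul0r.
by rewrite adde0.
Qed.

(** [heat_content] iterates real-valued integrals, so passing to the extended-valued double integral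
    requires each inner integral to be finite; a multiple of [x^(-a)] dominates it. *)
Lemma heat_content_slice (Xi1 Xi2 : R -> R) :
  Y1 = cutoff01 Xi1 -> Y2 = cutoff01 Xi2 -> Xi1 1 = 0 -> Xi2 1 = 0 ->
  heat_content (fun x => x `^ (- a) * Xi1 x) (fun x => x `^ (- b) * Xi2 x) t =
  \int[mu]_(q in `]0, 1[) (weight a q * slice_int q + weight a (- q) * slice_int (- q)).
Proof.
move=> E1 E2 X1 X2; rewrite [RHS]/Rintegral -integral_heat_density.
have an0 : - a != 0 by rewrite oppr_eq0 gt_eqF//; case/andP: a01.
have bn0 : - b != 0.
  have : a < 1 by case/andP: a01.
  by rewrite oppr_eq0 -ab1 ltrDl => /gt_eqF ->.
(* Extension by 0 changes nothing at the end points: at 0 a nonzero power of 0 is 0, and at 1 the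
   cut-off already vanishes. *)
have cX (c : R) (X : R -> R) x : - c != 0 -> X 1 = 0 -> 0 <= x <= 1 ->
    x `^ (- c) * X x = x `^ (- c) * cutoff01 X x.
  move=> cn0 X10 /andP[]; rewrite cutoff01E le_eqVlt => /predU1P[<- _|x0].
    by rewrite powR0// !mul0r.
  by rewrite x0 le_eqVlt => /predU1P[->|->//]; rewrite X10 ltxx.
have Z1 x : ~~ (0 <= x <= 1) -> Y1 x = 0.
  rewrite negb_and -!ltNge => /orP[x0|x1]; apply: Y1z; first by left; exact: ltW.
  by right; lra.
have Z2 x : ~~ (0 <= x <= 1) -> Y2 x = 0.
  rewrite negb_and -!ltNge => /orP[x0|x1]; apply: Y2z; first by left; exact: ltW.
  by right; lra.
have inner y : 0 <= y <= 1 ->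
    (\int[mu]_(x in `[0%R, 1%R])
       (heat_kernel x y t * (x `^ (- a) * Xi1 x) * (y `^ (- b) * Xi2 y))%:E =
     \int[mu]_x (heat_density x y)%:E)%E.
  move=> y01; rewrite integral_mkcond; apply: eq_integral => x _.
  rewrite patchE mem_setE in_itv/=; case: ifPn => [x01|/Z1 Yx].
    by rewrite /heat_density E1 E2 -!cX.
  by rewrite /heat_density Yx !mulr0 mul0r.
have fin y : (\int[mu]_x (heat_density x y)%:E \is a fin_num)%E.
  pose C := (Num.sqrt (4 * pi * t))^-1 * (y `^ (- b) * Y2 y).
  have ii : mu.-integrable `[0, 1] (EFin \o (fun x => C * x `^ (- a))).
    apply: (integrableZl _ C (integrable_powR01 _)) => //.
    by rewrite ltrN2; case/andP: a01.
  have -> : (\int[mu]_x (heat_density x y)%:E = \int[mu]_(x in `[0%R, 1%R]) (heat_density x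
    y)%:E)%E.
    rewrite [RHS]integral_mkcond; apply: eq_integral => x _.
    rewrite patchE mem_setE in_itv/=; case: ifPn => // /Z1 Yx.
    by rewrite /heat_density Yx !mulr0 mul0r.
  apply: integrable_fin_num => //.
  apply: le_integrable ii => //.
    apply/measurable_EFinP; apply: measurable_funTS.
    by have := @measurable_fun_pair1 _ _ _ _ _ _ _ y measurable_heat_density.
  move=> x _; rewrite lee_fin.
  have /andP[A0 A1] := Y1_01 x; have /andP[B0 B1] := Y2_01 y.
  have C0 : 0 <= C by rewrite !mulr_ge0 ?powR_ge0// invr_ge0 sqrtr_ge0.
  rewrite !ger0_norm ?heat_density_ge0 ?mulr_ge0 ?powR_ge0//.
  rewrite /heat_density -mulrA /C -[leRHS]mulrA; apply: ler_pM.
  - exact: heat_kernel_ge0.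
  - by rewrite !mulr_ge0 ?powR_ge0.
  - rewrite /heat_kernel ler_piMr ?invr_ge0 ?sqrtr_ge0//.
    rewrite -[leRHS]expR0 ler_expR mulNr oppr_le0 divr_ge0 ?sqr_ge0// mulr_ge0// ltW//.
  - rewrite [leRHS]mulrC ler_wpM2r ?mulr_ge0 ?powR_ge0//.
    by rewrite ler_piMr ?powR_ge0.
rewrite /heat_content /Rintegral; apply: (congr1 fine).
rewrite integral_mkcond; apply: eq_integral => y _.
rewrite patchE mem_setE in_itv/=; case: ifPn => [y01|/Z2 Yy].
  by rewrite inner// fineK.
rewrite integral0_eq// => x _.
by rewrite /heat_density Yy !mulr0.
Qed.

End HeatSlices.

(** * Asymptotics *)

Section DoubleIntegrals.
Context {R : realType}.
Local Notation mu := (@lebesgue_measure R).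

Lemma Rintegral_itv_oo (x y : R) (f : R -> R) : measurable_fun `]x, y[ f ->
  \int[mu]_(z in `[x, y]) f z = \int[mu]_(z in `]x, y[) f z.
Proof.
move=> mf; rewrite /Rintegral; apply: (congr1 fine).
have := @integral_itv_bndoo R x y (EFin \o f) true false; apply.
exact/measurable_EFinP.
Qed.

(** Serves where a product of cut-offs equals 1 on an open interval but is 0 at its end point 0. *)
Lemma eq_Rintegral_oo (x y : R) (f g : R -> R) :
  measurable_fun `]x, y[ f -> (forall z, x < z < y -> f z = g z) ->
  \int[mu]_(z in `[x, y]) f z = \int[mu]_(z in `[x, y]) g z.
Proof.
move=> mf fg; have mg : measurable_fun `]x, y[ g.
  apply: eq_measurable_fun mf => z; rewrite inE/= in_itv/=; exact: fg.
rewrite !Rintegral_itv_oo//; apply: eq_Rintegral => z.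
by rewrite inE/= in_itv/=; exact: fg.
Qed.

Lemma Rintegral_swap (A B : set R) (M : R) (h : R -> R -> R) :
  measurable A -> measurable B -> (mu A < +oo)%E -> (mu B < +oo)%E ->
  measurable_fun setT (fun z : R * R => h z.1 z.2) ->
  (forall x y, 0 <= h x y <= M) ->
  \int[mu]_(x in A) (\int[mu]_(y in B) h x y) =
  \int[mu]_(y in B) (\int[mu]_(x in A) h x y).
Proof.
move=> mA mB fA fB mh h0.
have M0 : 0 <= M by have /andP[] := h0 0 0; exact: le_trans.
have bnd (D : set R) (g : R -> R) : measurable D -> (mu D < +oo)%E -> measurable_fun setT g
  -> (forall x, 0 <= g x <= M) ->
    mu.-integrable D (EFin \o g).
  move=> mD fD mg g0; apply: measurable_bounded_integrable => //.
    exact: measurable_funTS.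
  exists M; split; first exact: num_real.
  move=> x Mx z _ /=; have /andP[g00 gM] := g0 z; rewrite ger0_norm//.
  exact: le_trans (ltW Mx).
have E1 x : (\int[mu]_(y in B) (h x y)%:E)%E = (\int[mu]_(y in B) h x y)%:E.
  rewrite /Rintegral fineK//; apply: integrable_fin_num => //; apply: bnd => //.
  by have := @measurable_fun_pair2 _ _ _ _ _ _ _ x mh.
have E2 y : (\int[mu]_(x in A) (h x y)%:E)%E = (\int[mu]_(x in A) h x y)%:E.
  rewrite /Rintegral fineK//; apply: integrable_fin_num => //; apply: bnd => //.
  by have := @measurable_fun_pair1 _ _ _ _ _ _ _ y mh.
rewrite {1}/Rintegral [RHS]/Rintegral; apply: (congr1 fine).
under eq_integral do rewrite -E1.
under [RHS]eq_integral do rewrite -E2.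
pose g (z : R * R) := (\1_A z.1 * \1_B z.2 * h z.1 z.2)%:E.
have mg : measurable_fun setT g.
  apply/measurable_EFinP; apply: measurable_funM => //; apply: measurable_funM.
    by apply: (@measurableT_comp _ _ _ _ _ _ (\1_A : R -> R)).
  by apply: (@measurableT_comp _ _ _ _ _ _ (\1_B : R -> R)).
have g0 z : (0 <= g z)%E.
  by have /andP[h00 _] := h0 z.1 z.2; rewrite lee_fin mulr_ge0// !indicE mulr_ge0.
have := @fubini_tonelli _ _ _ _ R mu mu g mg g0.
congr (_ = _).
- rewrite [RHS]integral_mkcond; apply: eq_integral => x _; rewrite patchE.
  case: ifPn => xA; last first.
    by apply: integral0_eq => y _; rewrite /g /= indicE (negbTE xA) !mul0r.
  rewrite [RHS]integral_mkcond; apply: eq_integral => y _.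
  by rewrite /g /= epatch_indic/= indicE xA mul1r EFinM muleC.
- rewrite [RHS]integral_mkcond; apply: eq_integral => y _; rewrite patchE.
  case: ifPn => yB; last first.
    by apply: integral0_eq => x _; rewrite /g /= [\1_B _]indicE (negbTE yB) mulr0 mul0r.
  rewrite [RHS]integral_mkcond; apply: eq_integral => x _.
  by rewrite /g /= epatch_indic/= [\1_B _]indicE yB mulr1 EFinM muleC.
Qed.

Lemma Rintegral_xgauss_le (k : R) : 0 < k ->
  \int[mu]_(q in `[0, 1]) (q * expR (- (k * q ^+ 2))) <= (2 * k)^-1.
Proof.
move=> k0.
have d (x : R) : is_derive x 1 (fun q : R => - (2 * k)^-1 * expR (- (k * q ^+ 2)))
   (x * expR (- (k * x ^+ 2))).
  have h1 := is_derive_ptN (is_derive_ptM (is_derive_ptc k x) (is_derive_ptX 2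
    (is_derive_ptid x))).
  have h2 := is_derive_ptM (is_derive_ptc (- (2 * k)^-1) x)
     (is_derive_ptcomp (f := fun q => - (k * q ^+ 2)) (is_derive_expR _) h1).
  apply: (is_derive_eq h2); rewrite /= expr1 mulr0; field.
  by rewrite gt_eqF.
have c (x : R) : {for x, continuous (fun q : R => q * expR (- (k * q ^+ 2)))}.
  apply: cvgM; first exact: cvg_id.
  have h1 := is_derive_ptN (is_derive_ptM (is_derive_ptc k x) (is_derive_ptX 2
    (is_derive_ptid x))).
  exact: is_derive_continuous (is_derive_ptcomp (f := fun q => - (k * q ^+ 2))
    (is_derive_expR _) h1).
rewrite (RFTC2_is_derive ler01 (fun x _ => d x) (fun x _ => c x)).
rewrite expr0n/= mulr0 oppr0 expR0 mulr1 opprK gerDr mulNr oppr_le0.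
by rewrite mulr_ge0 ?expR_ge0// invr_ge0 mulr_ge0// ltW.
Qed.

End DoubleIntegrals.

Section IntegralDistance.
Context {R : realType}.
Local Notation mu := (@lebesgue_measure R).

Lemma Rintegral_dist_le_fun (D : set R) (f g h : R -> R) : measurable D ->
  mu.-integrable D (EFin \o f) -> mu.-integrable D (EFin \o g) ->
  mu.-integrable D (EFin \o h) -> (forall x, D x -> `|f x - g x| <= h x) ->
  `|\int[mu]_(x in D) f x - \int[mu]_(x in D) g x| <= \int[mu]_(x in D) h x.
Proof.
move=> mD fi gi hi fgh; rewrite -RintegralB//.
have hI : mu.-integrable D (EFin \o (fun t => f t - g t)).
  by have /(_ mD) := integrableB _ fi gi.
apply: (le_trans (le_normr_Rintegral _ hI)) => //.
apply: le_Rintegral => //.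
exact: (@integrable_norm _ _ _ mu _ (fun t => f t - g t)).
Qed.

End IntegralDistance.

(** * Explicit error bounds of order [sqrt t] *)

Section Estimates.
Context {R : realType}.
Local Notation mu := (@lebesgue_measure R).
Variables (a b t : R) (Y1 Y2 : R -> R) (d d1 d2 L1 L2 : R).
Hypotheses (a01 : 0 < a < 1) (ab1 : a + b = 1) (t0 : 0 < t).
Hypotheses (bY1 : lipschitz_bump d1 L1 Y1) (bY2 : lipschitz_bump d2 L2 Y2).
Hypotheses (L10 : 0 <= L1) (L20 : 0 <= L2).
Hypotheses (d0 : 0 < d) (dd1 : 2 * d <= d1) (dd2 : 2 * d <= d2) (dh : d < 2^-1).

Let G s := Y1 s * Y2 s.
Let sp : R := Num.sqrt pi.
Let st := Num.sqrt t.
Let c := (Num.sqrt (pi * t))^-1.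

Definition diag_slice q s : R := c * expR (- (q / st * s) ^+ 2) * G s.
Definition diag_int q : R := \int[mu]_(s in `[0, 2^-1]) diag_slice q s.

Let sp0 : 0 < sp. Proof. by rewrite sqrtr_gt0 pi_gt0. Qed.
Let st0 : 0 < st. Proof. by rewrite sqrtr_gt0. Qed.
Let stt : st ^+ 2 = t. Proof. by rewrite sqr_sqrtr// ltW. Qed.
Let cE : c = sp^-1 * st^-1. Proof. by rewrite /c sqrtrM ?invfM// ltW// pi_gt0. Qed.
Let c0 : 0 < c. Proof. by rewrite cE mulr_gt0 ?invr_gt0. Qed.
Let Y1_01 x : 0 <= Y1 x <= 1. Proof. by case: bY1. Qed.
Let Y2_01 x : 0 <= Y2 x <= 1. Proof. by case: bY2. Qed.
Let mY1 : measurable_fun setT Y1. Proof. by case: bY1. Qed.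
Let mY2 : measurable_fun setT Y2. Proof. by case: bY2. Qed.
Let mG : measurable_fun setT G. Proof. exact: measurable_funM. Qed.
Let G01 s : 0 <= G s <= 1.
Proof.
have /andP[A0 A1] := Y1_01 s; have /andP[B0 B1] := Y2_01 s.
by rewrite mulr_ge0//= mulr_ile1.
Qed.
Let Y1d x : 0 < x < 2 * d -> Y1 x = 1.
Proof.
move=> /andP[x0 xd]; case: bY1 => _ _ h _ _; apply: h.
by rewrite x0 (lt_le_trans xd).
Qed.
Let Y2d x : 0 < x < 2 * d -> Y2 x = 1.
Proof.
move=> /andP[x0 xd]; case: bY2 => _ _ h _ _; apply: h.
by rewrite x0 (lt_le_trans xd).
Qed.
Let Gd x : 0 < x <= d -> G x = 1.
Proof.
move=> /andP[x0 xd]; rewrite /G Y1d ?Y2d ?mulr1// x0/=; lra.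
Qed.

(** If [s <= d], both [s (1 + q)] and [s (1 - q)] are below [2 d], within the plateaus, and the
    difference is 0. If [s > d], the Gaussian is at most its value at [s = d] and each cut-off moves
    by at most [L s |q|]. *)
Lemma slice_diag_dist q s : -1 < q < 1 -> 0 <= s <= 2^-1 ->
  `|slice t Y1 Y2 q s - diag_slice q s| <=
  c * (L1 + L2) * (`|q| * expR (- (d ^+ 2 / t * q ^+ 2))).
Proof.
move=> /andP[qN q1] /andP[s0 s2].
have K0 : 0 <= c * (L1 + L2) * (`|q| * expR (- (d ^+ 2 / t * q ^+ 2))).
  by rewrite mulr_ge0 ?mulr_ge0 ?expR_ge0 ?addr_ge0// ltW.
rewrite /slice /diag_slice -/st -/c -mulrBr.
have [E|sn0] := eqVneq s 0.
  by rewrite E !mul0r /G subrr mulr0 normr0.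
have {}s0 : 0 < s by rewrite lt_neqAle eq_sym sn0.
have x0 : 0 < s * (1 + q) by rewrite mulr_gt0//; lra.
have y0 : 0 < s * (1 - q) by rewrite mulr_gt0//; lra.
have [sd|ds] := leP s d.
  rewrite Gd ?s0// Y1d; last by rewrite x0/=; nra.
  rewrite Y2d; last by rewrite y0/=; nra.
  by rewrite mulr1 subrr mulr0 normr0.
have eE : expR (- (q / st * s) ^+ 2) <= expR (- (d ^+ 2 / t * q ^+ 2)).
  rewrite ler_expR lerN2 -stt.
  have -> : (q / st * s) ^+ 2 = s ^+ 2 / st ^+ 2 * q ^+ 2 by field; rewrite gt_eqF.
  rewrite ler_wpM2r ?sqr_ge0// ler_wpM2r ?invr_ge0 ?sqr_ge0//.
  by rewrite lerXn2r ?nnegrE// ltW.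
have D : `|Y1 (s * (1 + q)) * Y2 (s * (1 - q)) - G s| <= (L1 + L2) * `|q|.
  have -> : Y1 (s * (1 + q)) * Y2 (s * (1 - q)) - G s =
    (Y1 (s * (1 + q)) - Y1 s) * Y2 (s * (1 - q)) + Y1 s * (Y2 (s * (1 - q)) - Y2 s).
    by rewrite /G; ring.
  have /andP[A0 A1] := Y1_01 s; have /andP[B0 B1] := Y2_01 (s * (1 - q)).
  have sq : s * `|q| <= `|q| by rewrite ler_piMl//; lra.
  apply: (le_trans (ler_normD _ _)); rewrite [leRHS]mulrDl !normrM; apply: lerD.
    rewrite (ger0_norm B0); apply: (@le_trans _ _ (`|Y1 (s * (1 + q)) - Y1 s|));
      first by rewrite ler_piMr.
    case: bY1 => _ _ _ _ h; apply: (le_trans (h _ _ x0 s0)).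
    rewrite (_ : s * (1 + q) - s = s * q); last by ring.
    by rewrite normrM (gtr0_norm s0) ler_wpM2l.
  rewrite (ger0_norm A0); apply: (@le_trans _ _ (`|Y2 (s * (1 - q)) - Y2 s|));
    first by rewrite ler_piMl.
  case: bY2 => _ _ _ _ h; apply: (le_trans (h _ _ y0 s0)).
  rewrite (_ : s * (1 - q) - s = - (s * q)); last by ring.
  by rewrite normrN normrM (gtr0_norm s0) ler_wpM2l.
rewrite normrM (ger0_norm (mulr_ge0 (ltW c0) (expR_ge0 _))).
set e1 := expR _ in eE *; set e2 := expR _ in eE *.
have -> : c * (L1 + L2) * (`|q| * e2) = c * (e2 * ((L1 + L2) * `|q|)) by ring.
rewrite -mulrA ler_pM2l//; apply: ler_pM => //; exact: expR_ge0.
Qed.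

Lemma measurable_diag_slice : measurable_fun setT (fun z : R * R => diag_slice z.1 z.2).
Proof.
have m1 : measurable_fun setT (fun z : R * R => z.1) by exact: measurable_fst.
have m2 : measurable_fun setT (fun z : R * R => z.2) by exact: measurable_snd.
apply: measurable_funM; first apply: measurable_funM => //.
  apply: measurableT_comp => //; apply: measurableT_comp => //.
  by apply: measurable_funX; apply: measurable_funM => //; apply: measurable_funM.
exact: (measurableT_comp mG m2).
Qed.

Lemma diag_slice_bounds q s : 0 <= diag_slice q s <= c.
Proof.
have /andP[g0 g1] := G01 s; have c0' := ltW c0.
rewrite /diag_slice; set e := expR _; have e0 : 0 <= e by exact: expR_ge0.
move: g0 g1; move: (G s) => g g0 g1.
have e1 : e <= 1 by exact: gauss_fun_le1.
apply/andP; split; first by rewrite !mulr_ge0.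
by rewrite -mulrA ler_piMr// mulr_ile1.
Qed.

Lemma integrable_diag_slice q x y : mu.-integrable `[x, y] (EFin \o diag_slice q).
Proof.
apply: (@bounded_itv_integrable _ _ _ c).
  by apply: measurable_funTS; have := @measurable_fun_pair2 _ _ _ _ _ _ _ q measurable_diag_slice.
by move=> s _; have /andP[s0 s1] := diag_slice_bounds q s; rewrite ger0_norm.
Qed.

Lemma measurable_diag_int : measurable_fun setT diag_int.
Proof.
apply: measurable_Rintegral_param => //; first exact: measurable_diag_slice.
by move=> q s; case/andP: (diag_slice_bounds q s).
Qed.

Lemma diag_int_ge0 q : 0 <= diag_int q.
Proof. by apply: Rintegral_ge0 => s _; case/andP: (diag_slice_bounds q s). Qed.

Lemma slice_int_diag_dist q : -1 < q < 1 ->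
  `|slice_int t Y1 Y2 q - diag_int q| <=
  c * (L1 + L2) * (`|q| * expR (- (d ^+ 2 / t * q ^+ 2))).
Proof.
move=> q1; set K := leRHS.
have K0 : 0 <= K by rewrite mulr_ge0 ?mulr_ge0 ?expR_ge0 ?addr_ge0// ltW.
apply: (@le_trans _ _ (K * (2^-1 - 0))); last by rewrite subr0 ler_piMr//; lra.
apply: Rintegral_dist_le => //.
- exact (integrable_slice t bY1 bY2 q).
- exact: integrable_diag_slice.
- by move=> s s01; exact: slice_diag_dist.
Qed.

(** [1/(2q)] is the Gaussian integral over the whole half-line. From above, [G <= 1]; from below,
    [G = 1] on []0, d]], and the tail beyond [d] gives the error. *)
Lemma diag_int_bounds q : 0 < q ->
  0 <= (2 * q)^-1 - diag_int q <= st / (sp * d * q ^+ 2).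
Proof.
move=> q0; have k0 : 0 < q / st by rewrite divr_gt0.
have h2 : 0 < 2^-1 :> R by [].
have /andP[_ up] := gauss_itv_bounds k0 h2.
have /andP[lo _] := gauss_itv_bounds k0 d0.
have ig x y : mu.-integrable `[x, y] (EFin \o (fun s => c * expR (- (q / st * s) ^+ 2))).
  by apply: (integrableZl _ c (integrable_gauss_scale (q / st) x y)).
have U : diag_int q <= c * (sp / (2 * (q / st))).
  apply: (le_trans _ (ler_wpM2l (ltW c0) up)).
  rewrite -RintegralZl//; last exact: integrable_gauss_scale.
  apply: le_Rintegral => //; first exact: integrable_diag_slice.
  move=> s _; rewrite /diag_slice; have /andP[g0 g1] := G01 s.
  by rewrite ler_piMr// mulr_ge0 ?expR_ge0// ltW.
have L : c * (sp / (2 * (q / st)) - ((q / st) ^+ 2 * d)^-1) <= diag_int q.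
  apply: (le_trans (ler_wpM2l (ltW c0) lo)).
  rewrite -RintegralZl//; last exact: integrable_gauss_scale.
  rewrite /diag_int (Rintegral_itv_split (ltW d0) (ltW dh) (integrable_diag_slice q _ _)).
  rewrite -[leLHS]addr0; apply: lerD; last first.
    by apply: Rintegral_ge0 => s _; case/andP: (diag_slice_bounds q s).
  rewrite le_eqVlt; apply/orP; left; apply/eqP; apply: eq_Rintegral_oo.
    apply: measurable_funTS; apply: continuous_measurable_fun => s.
    by apply: cvgM; [exact: cvg_cst | exact: continuous_gauss_scale].
  by move=> s /andP[s0 sd]; rewrite /diag_slice Gd ?mulr1// s0 ltW.
have E1 : c * (sp / (2 * (q / st))) = (2 * q)^-1.
  by rewrite cE; field; rewrite !gt_eqF.
have E2 : c * ((q / st) ^+ 2 * d)^-1 = st / (sp * d * q ^+ 2).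
  by rewrite cE; field; rewrite !gt_eqF.
rewrite mulrBr E1 E2 in L; rewrite E1 in U.
apply/andP; split; first by rewrite subr_ge0.
by rewrite lerBlDr -lerBlDl.
Qed.

Let F q := sym_weight a q.
Let T q := weight a q * slice_int t Y1 Y2 q + weight a (- q) * slice_int t Y1 Y2 (- q).

(** After the passage to the diagonal, [F NG = 2 NG + (F - 2) NG] with [NG = diag_int q], and [NG]
    is replaced by [1/(2q)] only in the last term. There the factor [q^2] of [F - 2 <= q^2 F]
    cancels the [1/q^2] of [diag_int_bounds]. *)
Lemma heat_integrand_dist q : 0 < q < 1 ->
  `|T q - (2^-1 * (q^-1 * (F q - 2)) + 2 * diag_int q)| <=
  ((L1 + L2) / (sp * d ^+ 2) + (sp * d)^-1) * st * F q +
  2 * c * (L1 + L2) * (q * expR (- (d ^+ 2 / t * q ^+ 2))).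
Proof.
move=> q01; have /andP[q0 q1] := q01.
have /andP[F2 Fq] := sym_weight_bounds a01 q01; rewrite -/(F q) in F2 Fq.
have hq : -1 < q < 1 by rewrite q1 andbT (lt_trans _ q0)// oppr_lt0.
have hqN : -1 < - q < 1 by rewrite ltrN2 q1/= (lt_trans _ (@ltr01 R))// oppr_lt0.
have w0 := weight_ge0 a q; have w0' := weight_ge0 a (- q).
have D1 := slice_int_diag_dist hq.
have := slice_int_diag_dist hqN.
have -> : diag_int (- q) = diag_int q.
  by apply: eq_Rintegral => s _; rewrite /diag_slice !mulNr sqrrN.
rewrite normrN sqrrN (gtr0_norm q0) => D2; rewrite (gtr0_norm q0) in D1.
have /andP[N1 N2] := diag_int_bounds q0.
rewrite /T; set N := slice_int t Y1 Y2 q in D1 *; set N' := slice_int t Y1 Y2 (- q) in D2 *.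
set NG := diag_int q in D1 D2 N1 N2 *.
set E := q * expR _ in D1 D2 *.
have FE : F q = weight a (- q) + weight a q by [].
have -> : weight a q * N + weight a (- q) * N' - (2^-1 * (q^-1 * (F q - 2)) + 2 * NG) =
   weight a q * (N - NG) + weight a (- q) * (N' - NG) - (F q - 2) * ((2 * q)^-1 - NG).
  by rewrite FE; field; rewrite gt_eqF.
have B1 : `|weight a q * (N - NG)| <= weight a q * (c * (L1 + L2) * E).
  by rewrite normrM (ger0_norm w0) ler_wpM2l.
have B2 : `|weight a (- q) * (N' - NG)| <= weight a (- q) * (c * (L1 + L2) * E).
  by rewrite normrM (ger0_norm w0') ler_wpM2l.
have B3 : `|(F q - 2) * ((2 * q)^-1 - NG)| <= (sp * d)^-1 * st * F q.
  rewrite normrM (ger0_norm F2) (ger0_norm N1).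
  apply: (@le_trans _ _ (q ^+ 2 * F q * (st / (sp * d * q ^+ 2)))).
    by apply: ler_pM.
  by rewrite le_eqVlt; apply/orP; left; apply/eqP; field; rewrite !gt_eqF.
(* The product of [F] and the Gaussian error is split by [F <= 2 + q^2 F]: the term with 2 is
   integrated later, and in the other one [q^2 E <= t / d^2] leaves an integrable multiple of
   [F]. *)
have B4 : F q * (c * (L1 + L2) * E) <=
   (L1 + L2) / (sp * d ^+ 2) * st * F q + 2 * c * (L1 + L2) * E.
  have K0 : 0 <= c * (L1 + L2) by rewrite mulr_ge0 ?addr_ge0// ltW.
  have E0 : 0 <= E by rewrite mulr_ge0 ?expR_ge0// ltW.
  have F0 : 0 <= F q by rewrite addr_ge0.
  have qE : q ^+ 2 * E <= t / d ^+ 2.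
    have k0 : 0 < d ^+ 2 / t * q ^+ 2 by rewrite mulr_gt0 ?divr_gt0 ?exprn_gt0.
    have e1 : expR (- (d ^+ 2 / t * q ^+ 2)) <= (d ^+ 2 / t * q ^+ 2)^-1.
      rewrite expRN lef_pV2 ?posrE ?expR_gt0//.
      by apply: (le_trans _ (expR_ge1Dx _)); rewrite lerDr.
    apply: (@le_trans _ _ (q ^+ 2 * (q * (d ^+ 2 / t * q ^+ 2)^-1))).
      by rewrite /E !ler_wpM2l ?sqr_ge0// ltW.
    have -> : q ^+ 2 * (q * (d ^+ 2 / t * q ^+ 2)^-1) = q * (t / d ^+ 2).
      by field; rewrite !gt_eqF.
    by rewrite ler_piMl ?ltW// divr_gt0// exprn_gt0.
  have h1 : F q * (c * (L1 + L2) * E) <= (2 + q ^+ 2 * F q) * (c * (L1 + L2) * E).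
    by apply: ler_wpM2r; [exact: mulr_ge0 | rewrite -lerBlDl].
  apply: (le_trans h1).
  have -> : (2 + q ^+ 2 * F q) * (c * (L1 + L2) * E) =
     c * (L1 + L2) * F q * (q ^+ 2 * E) + 2 * c * (L1 + L2) * E by ring.
  rewrite lerD2r.
  apply: (@le_trans _ _ (c * (L1 + L2) * F q * (t / d ^+ 2))).
    by apply: ler_wpM2l => //; apply: mulr_ge0.
  by rewrite le_eqVlt; apply/orP; left; apply/eqP; rewrite cE -[in LHS]stt; field;
    rewrite !gt_eqF.
apply: (le_trans (ler_normB _ _)); apply: (le_trans (lerD (ler_normD _ _) (lexx _))).
apply: (le_trans (lerD (lerD B1 B2) B3)).
have -> : weight a q * (c * (L1 + L2) * E) + weight a (- q) * (c * (L1 + L2) * E) =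
  F q * (c * (L1 + L2) * E) by rewrite FE; ring.
apply: (le_trans (lerD B4 (lexx _))).
by rewrite le_eqVlt; apply/orP; left; apply/eqP; ring.
Qed.



Let IF : R := \int[mu]_(q in `[0, 1]) F q.
Let IF2 : R := \int[mu]_(q in `[0, 1]) (q^-1 * (F q - 2)).

Lemma slice_int_le q : slice_int t Y1 Y2 q <= c.
Proof.
have h2 : 0 <= 2^-1 :> R by [].
have := @Rintegral_le_cst R 0 2^-1 c _ h2 (integrable_slice t bY1 bY2 q).
move=> h; apply: (le_trans (h _)).
  by move=> s _; case/andP: (slice_bounds t bY1 bY2 q s).
by rewrite subr0 ler_piMr ?(ltW c0)//; lra.
Qed.

(** In the integrated bound the Gaussian term contributes [2 c (L1 + L2) t / (2 d^2)], and
    [c = 1/sqrt(pi t)] turns it into the last summand. *)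
Lemma heat_integral_dist :
  `|\int[mu]_(q in `]0, 1[) T q - (2^-1 * IF2 + 2 * \int[mu]_(q in `[0, 1]) diag_int q)| <=
  (((L1 + L2) / (sp * d ^+ 2) + (sp * d)^-1) * IF + (L1 + L2) / (sp * d ^+ 2)) * st.
Proof.
have oc : (`]0, 1[%classic : set R) `<=` `[0, 1]%classic.
  by move=> x /=; rewrite !in_itv/= => /andP[x0 x1]; rewrite !ltW.
have iS (f : R -> R) : mu.-integrable `[0, 1] (EFin \o f) -> mu.-integrable `]0, 1[ (EFin \o f).
  by move=> fi; apply: integrableS fi => //; exact: oc.
have iF : mu.-integrable `[0, 1] (EFin \o F) by exact: integrable_sym_weight.
have iF2 : mu.-integrable `[0, 1] (EFin \o (fun q => q^-1 * (F q - 2))).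
  exact: integrable_sym_weight_div.
have iD : mu.-integrable `[0, 1] (EFin \o diag_int).
  apply: (@bounded_itv_integrable _ _ _ c).
    by apply: measurable_funTS; exact: measurable_diag_int.
  move=> q _; rewrite ger0_norm ?diag_int_ge0//.
  have h2 : 0 <= 2^-1 :> R by [].
  apply: (le_trans (@Rintegral_le_cst R 0 2^-1 c _ h2 (integrable_diag_slice q _ _) _)).
    by move=> s _; case/andP: (diag_slice_bounds q s).
  by rewrite subr0 ler_piMr ?(ltW c0)//; lra.
pose k := d ^+ 2 / t.
have k0 : 0 < k by rewrite divr_gt0// exprn_gt0.
have iE : mu.-integrable `[0, 1] (EFin \o (fun q => q * expR (- (k * q ^+ 2)))).
  apply: continuous_itv_integrable => x _; apply: cvgM; first exact: cvg_id.
  have h1 := is_derive_ptN (is_derive_ptM (is_derive_ptc k x) (is_derive_ptX 2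
    (is_derive_ptid x))).
  exact: is_derive_continuous (is_derive_ptcomp (f := fun q => - (k * q ^+ 2))
    (is_derive_expR _) h1).
pose g q := 2^-1 * (q^-1 * (F q - 2)) + 2 * diag_int q.
have i1 : mu.-integrable `[0, 1] (EFin \o (fun q => 2^-1 * (q^-1 * (F q - 2)))).
  by apply: (integrableZl _ _ iF2).
have i2 : mu.-integrable `[0, 1] (EFin \o (fun q => 2 * diag_int q)).
  by apply: (integrableZl _ _ iD).
have ig : mu.-integrable `[0, 1] (EFin \o g).
  by have /(_ (measurable_itv _)) := integrableD _ i1 i2.
pose C := ((L1 + L2) / (sp * d ^+ 2) + (sp * d)^-1) * st.
pose C' := 2 * c * (L1 + L2).
pose h q := C * F q + C' * (q * expR (- (k * q ^+ 2))).
have i3 : mu.-integrable `[0, 1] (EFin \o (fun q => C * F q)).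
  by apply: (integrableZl _ _ iF).
have i4 : mu.-integrable `[0, 1] (EFin \o (fun q => C' * (q * expR (- (k * q ^+ 2))))).
  by apply: (integrableZl _ _ iE).
have ih : mu.-integrable `[0, 1] (EFin \o h).
  by have /(_ (measurable_itv _)) := integrableD _ i3 i4.
have iT : mu.-integrable `]0, 1[ (EFin \o T).
  have icF : mu.-integrable `]0, 1[ (EFin \o (fun q => c * F q)).
    have iFo : mu.-integrable `]0, 1[ (EFin \o F) by exact: iS.
    by apply: (integrableZl _ _ iFo).
  apply: le_integrable icF => //.
    apply/measurable_EFinP; apply: measurable_funTS.
    apply: measurable_funD; apply: measurable_funM.
    - exact: measurable_weight.
    - exact (measurable_slice_int t bY1 bY2).
    - apply: measurableT_comp => //; exact: measurable_weight.
    - apply: (@measurableT_comp _ _ _ _ _ _ (slice_int t Y1 Y2)) => //;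
        exact (measurable_slice_int t bY1 bY2).
  move=> q _; rewrite lee_fin.
  have w0 := weight_ge0 a q; have w0' := weight_ge0 a (- q).
  have n0 x : 0 <= slice_int t Y1 Y2 x by exact (slice_int_ge0 t bY1 bY2 x).
  have T0 : 0 <= T q by rewrite addr_ge0// mulr_ge0.
  have F0 : 0 <= F q by rewrite addr_ge0.
  rewrite (ger0_norm T0) (ger0_norm (mulr_ge0 (ltW c0) F0)).
  rewrite (_ : c * F q = weight a q * c + weight a (- q) * c); last first.
    by rewrite /F /sym_weight; ring.
  by apply: lerD; apply: ler_wpM2l => //; exact: slice_int_le.
have mo (f : R -> R) : mu.-integrable `[0, 1] (EFin \o f) -> measurable_fun (`](0 : R), 1[) f.
  by move=> /iS fi; apply/measurable_EFinP; exact: measurable_int fi.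
have Eg : 2^-1 * IF2 + 2 * \int[mu]_(q in `[0, 1]) diag_int q = \int[mu]_(q in `]0, 1[) g q.
  rewrite -Rintegral_itv_oo; last exact: mo.
  by rewrite RintegralD// !RintegralZl.
have Eh : \int[mu]_(q in `]0, 1[) h q = C * IF + C' * \int[mu]_(q in `[0, 1]) (q * expR (-
  (k * q ^+ 2))).
  rewrite -Rintegral_itv_oo; last exact: mo.
  by rewrite RintegralD// !RintegralZl.
rewrite Eg; apply: (@le_trans _ _ (\int[mu]_(q in `]0, 1[) h q)).
  apply: Rintegral_dist_le_fun => //.
  - exact: iS.
  - exact: iS.
  - by move=> q /=; rewrite in_itv/= => /heat_integrand_dist.
rewrite Eh.
have C'0 : 0 <= C' by rewrite !mulr_ge0 ?addr_ge0// ltW.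
apply: (le_trans (lerD (lexx _) (ler_wpM2l C'0 (Rintegral_xgauss_le k0)))).
rewrite le_eqVlt; apply/orP; left; apply/eqP.
by rewrite /C /C' /k cE -[in LHS]stt; field; rewrite !gt_eqF.
Qed.

Let k s := 2 * c * gauss_mean (s / st).

Let mk : measurable_fun setT k.
Proof.
apply: measurable_funM => //; apply: measurableT_comp; first exact: measurable_gauss_mean.
exact: measurable_funM.
Qed.

Let ik x y : mu.-integrable `[x, y] (EFin \o (fun s => k s * G s)).
Proof.
apply: (@bounded_itv_integrable _ _ _ (2 * c)).
  by apply: measurable_funTS; exact: measurable_funM.
move=> s _; have /andP[g0 g1] := G01 s; have m0 := gauss_mean_ge0 (s / st).
have m1 := gauss_mean_le1 (s / st).
have c20 : 0 <= 2 * c by rewrite mulr_ge0// ltW.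
rewrite /k; move: (G s) g0 g1 => g g0 g1; move: (gauss_mean _) m0 m1 => m m0 m1.
by rewrite (ger0_norm (mulr_ge0 (mulr_ge0 c20 m0) g0)) -mulrA ler_piMr// mulr_ile1.
Qed.

(** The exponent is symmetric in [q] and [s], so integrating in [q] at fixed [s] gives
    [gauss_mean (s / st)]; the function [k] collects this with the prefactor [2 c]. *)
Lemma diag_integral_swap :
  2 * \int[mu]_(q in `[0, 1]) diag_int q = \int[mu]_(s in `[0, 2^-1]) (k s * G s).
Proof.
have fin (x y : R) : (mu `[x, y]%classic < +oo)%E.
  by rewrite lebesgue_measure_itv/=; case: ifP => // _; rewrite -EFinD ltry.
rewrite /diag_int (Rintegral_swap (measurable_itv _) (measurable_itv _) (fin _ _) (fin _ _)
  measurable_diag_slice diag_slice_bounds).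
have E s : \int[mu]_(q in `[0, 1]) diag_slice q s = 2^-1 * (k s * G s).
  transitivity (\int[mu]_(q in `[0, 1]) (c * G s * expR (- (s / st * q) ^+ 2))).
    apply: eq_Rintegral => q _; rewrite /diag_slice.
    by rewrite (_ : q / st * s = s / st * q); ring.
  rewrite RintegralZl//; last exact: integrable_gauss_scale.
  by rewrite /k /gauss_mean; field.
have -> : \int[mu]_(s in `[0, 2^-1]) \int[mu]_(q in `[0, 1]) diag_slice q s =
    \int[mu]_(s in `[0, 2^-1]) (2^-1 * (k s * G s)) by apply: eq_Rintegral => s _; exact: E.
by rewrite RintegralZl// mulrA mulfV// mul1r.
Qed.

Let p : R := sp / 2.
Let p0 : 0 < p. Proof. by rewrite divr_gt0. Qed.

Lemma diag_integral_near0 :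
  \int[mu]_(s in `[0, d]) (k s * G s) = gauss_mean_int (d / st) / p.
Proof.
have m0 : 0 < d / st by rewrite divr_gt0.
have -> : \int[mu]_(s in `[0, d]) (k s * G s) = \int[mu]_(s in `[0, d]) k s.
  apply: eq_Rintegral_oo; first by apply: measurable_funTS; exact: measurable_funM.
  by move=> s /andP[s0 sd]; rewrite Gd ?mulr1// s0 ltW.
have ks s : 0 <= k s by rewrite mulr_ge0 ?gauss_mean_ge0// mulr_ge0// ltW.
rewrite Rintegral_scale01//; last exact: measurable_funTS.
rewrite /gauss_mean_int Rintegral_scale01//; last 2 first.
- by apply: measurable_funTS; exact: measurable_gauss_mean.
- by move=> x _; exact: gauss_mean_ge0.
have igm : mu.-integrable `[0, 1] (EFin \o (fun y => gauss_mean (d / st * y))).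
  apply: (@bounded_itv_integrable _ _ _ 1).
    apply: measurable_funTS; apply: measurableT_comp; first exact: measurable_gauss_mean.
    exact: measurable_funM.
  by move=> x _; rewrite ger0_norm ?gauss_mean_ge0// gauss_mean_le1.
have -> : \int[mu]_(y in `[0, 1]) k (d * y) = \int[mu]_(y in `[0, 1]) (2 * c * gauss_mean
  (d / st * y)).
  by apply: eq_Rintegral => y _; rewrite /k [d * y / st]mulrAC.
rewrite RintegralZl// /p cE; set J := \int[mu]_(y in _) _.
by field; rewrite !gt_eqF.
Qed.

Let H : R := \int[mu]_(s in `[d, 2^-1]) (Y1 s * Y2 s * s^-1).

(** For [s >= d] the argument [s / st] is large and [gauss_mean_bounds] gives [k s = 1/s] up to a
    term of order [sqrt t / s^2]. *)
Lemma diag_integral_away :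
  `|\int[mu]_(s in `[d, 2^-1]) (k s * G s) - H| <= 2 / (sp * d ^+ 2) * st.
Proof.
have mi (D : set R) : measurable_fun D (fun s : R => G s * s^-1).
  by apply: measurable_funTS; apply: measurable_funM => //; exact: measurable_inv.
have C0 : 0 <= 2 / (sp * d ^+ 2) * st.
  by rewrite mulr_ge0 ?divr_ge0 ?mulr_ge0 ?sqr_ge0// ltW.
apply: (@le_trans _ _ (2 / (sp * d ^+ 2) * st * (2^-1 - d))); last first.
  by apply: ler_piMr => //; move: d0; lra.
apply: Rintegral_dist_le.
- exact: ltW.
- exact: ik.
- apply: (@bounded_itv_integrable _ _ _ d^-1); first exact: mi.
  move=> s /andP[ds _]; have s0 : 0 < s by exact: lt_le_trans ds.
  have /andP[g0 g1] := G01 s; have g0' : 0 <= Y1 s * Y2 s by [].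
  rewrite ger0_norm; last by rewrite (mulr_ge0 g0')// invr_ge0 ltW.
  apply: (@le_trans _ _ s^-1); last by rewrite lef_pV2 ?posrE.
  by rewrite ler_piMl// invr_ge0 ltW.
- move=> s /andP[ds _]; have s0 : 0 < s by exact: lt_le_trans ds.
  rewrite -/(G s); have /andP[g0 g1] := G01 s; move: (G s) g0 g1 => g g0 g1.
  have u0 : 0 < s / st by rewrite divr_gt0.
  have /andP[lo up] := gauss_mean_bounds u0; rewrite -/sp in lo up.
  have c20 : 0 <= 2 * c by rewrite mulr_ge0// ltW.
  have E1 : 2 * c * (sp / 2 * (s / st)^-1) = s^-1.
    by rewrite cE; field; rewrite !gt_eqF.
  have E2 : 2 * c * (s / st) ^- 2 = 2 / (sp * s ^+ 2) * st.
    by rewrite cE; field; rewrite !gt_eqF.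
  have := ler_wpM2l c20 up; have := ler_wpM2l c20 lo; rewrite mulrBr E1 E2 -/(k s) => lo' up'.
  rewrite (mulrC g) -mulrBl normrM (ger0_norm g0).
  apply: (@le_trans _ _ (`|k s - s^-1|)); first by rewrite ler_piMr.
  rewrite distrC ger0_norm ?subr_ge0//.
  apply: (@le_trans _ _ (2 / (sp * s ^+ 2) * st)).
    by rewrite lerBlDr -lerBlDl.
  rewrite ler_pM2r// ler_pM2l// lef_pV2 ?posrE ?mulr_gt0 ?exprn_gt0// ler_pM2l//.
  by rewrite lerXn2r ?nnegrE// ltW.
Qed.

(** Below [d] the asymptotics of [gauss_mean_int] apply at [M = d / sqrt t]; the whole dependence on
    [ln t] comes from [ln M = ln d - (ln t) / 2]. *)
Lemma diag_integral_asymp :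
  `|2 * \int[mu]_(q in `[0, 1]) diag_int q -
    (H + ln d + 2^-1 * euler_gamma R + ln 2 - 2^-1 * ln t)| <=
  (2 / (sp * d ^+ 2) + (p * d)^-1) * st.
Proof.
rewrite diag_integral_swap (Rintegral_itv_split (ltW d0) (ltW dh) (ik _ _)) diag_integral_near0.
have m0 : 0 < d / st by rewrite divr_gt0.
have A1 := gauss_mean_int_asymp m0; rewrite -/sp -/p in A1.
have A2 := diag_integral_away.
set X := gauss_mean_int _ / p in A1 *; set Z := \int[mu]_(s in `[d, 2^-1]) (k s * G s) in A2 *.
have lE : ln (d / st) = ln d - 2^-1 * ln t.
  by rewrite ln_div ?posrE// /st -powR12_sqrt ?ln_powR// ltW.
have -> : X + Z - (H + ln d + 2^-1 * euler_gamma R + ln 2 - 2^-1 * ln t) =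
   (X - ln (d / st) - (2^-1 * euler_gamma R + ln 2)) + (Z - H) by rewrite lE; ring.
apply: (le_trans (ler_normD _ _)); apply: (le_trans (lerD A1 A2)).
by rewrite le_eqVlt; apply/orP; left; apply/eqP; field; rewrite !gt_eqF.
Qed.

End Estimates.

(** * Independence of the constant from the cut-off point *)

Section Renormalization.
Context {R : realType}.
Local Notation mu := (@lebesgue_measure R).

(* Lowering the cut-off point [d] to [eps] changes the integral by
   [ln d - ln eps], so that [ln eps + \int_eps^(1/2)] does not depend on [eps]. *)
Lemma bump_integral_shift (Xi1 Xi2 : R -> R) (d d1 d2 L1 L2 eps : R) :
  lipschitz_bump d1 L1 (cutoff01 Xi1) -> lipschitz_bump d2 L2 (cutoff01 Xi2) ->
  2 * d <= d1 -> 2 * d <= d2 -> d < 2^-1 -> 0 < eps -> eps <= d ->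
  \int[mu]_(x in `[eps, 2^-1]) (Xi1 x * Xi2 x * x^-1) =
  ln d - ln eps + \int[mu]_(x in `[d, 2^-1]) (cutoff01 Xi1 x * cutoff01 Xi2 x * x^-1).
Proof.
move=> [mY1 Y101 Y1d _ _] [mY2 Y201 Y2d _ _] dd1 dd2 dh e0 ed.
have d0 : 0 < d by exact: lt_le_trans ed.
pose g x := cutoff01 Xi1 x * cutoff01 Xi2 x * x^-1.
have ig : mu.-integrable `[eps, 2^-1] (EFin \o g).
  apply: (@bounded_itv_integrable _ _ _ eps^-1).
    apply: measurable_funTS; apply: measurable_funM; last exact: measurable_inv.
    exact: measurable_funM.
  move=> x /andP[ex _]; have x0 : 0 < x by exact: lt_le_trans ex.
  have /andP[A0 A1] := Y101 x; have /andP[B0 B1] := Y201 x.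
  rewrite /g ger0_norm; last by rewrite !mulr_ge0// invr_ge0 ltW.
  apply: (@le_trans _ _ x^-1); last by rewrite lef_pV2 ?posrE.
  by rewrite ler_piMl ?mulr_ile1// invr_ge0 ltW.
have -> : \int[mu]_(x in `[eps, 2^-1]) (Xi1 x * Xi2 x * x^-1) = \int[mu]_(x in `[eps, 2^-1]) g x.
  apply: eq_Rintegral => x; rewrite inE/= in_itv/= => /andP[ex xh].
  have x1 : x < 1 by apply: (le_lt_trans xh); rewrite invf_lt1// ltr1n.
  by rewrite /g !cutoff01E (lt_le_trans e0 ex) x1.
rewrite (Rintegral_itv_split ed (ltW dh) ig); congr (_ + _).
have xgt0 (x : R) : eps <= x <= d -> 0 < x by move=> /andP[ex _]; exact: lt_le_trans ex.
have -> : \int[mu]_(x in `[eps, d]) g x = \int[mu]_(x in `[eps, d]) x^-1.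
  apply: eq_Rintegral => x; rewrite inE/= in_itv/= => xed.
  have x0 := xgt0 _ xed; have /andP[_ xd] := xed.
  by rewrite /g Y1d ?Y2d ?mul1r// x0/=; lra.
rewrite (RFTC2_is_derive ed (fun x xed => is_derive1_ln (xgt0 x xed)))//.
by move=> x /xgt0 x0; apply: cvgV => //; rewrite gt_eqF.
Qed.

End Renormalization.

(** * The expansion and its constant *)

Theorem theorem1p2 (R : realType) (a b : R) (Xi1 Xi2 : R -> R)
    (ha : a < 1) (hb : b < 1) (hab : a + b = 1)
    (hXi1 : cutoff Xi1) (hXi2 : cutoff Xi2) :
  exists beta0 : R,
    (\forall eps \near 0^'+,
       beta0 =
         2^-1 * ln (eps ^+ 2) + 2^-1 * euler_gamma R
         + ln (Num.sqrt 2 - 1) + 2 * ln 2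
         + \int[lebesgue_measure]_(x in `[eps, 2^-1]) (Xi1 x * Xi2 x * x^-1)
         + 2^-1 * \int[lebesgue_measure]_(q in `[0, 1])
             (q^-1 * ((1 + q) `^ (a - 1) / (1 - q) `^ a
                      + (1 - q) `^ (a - 1) / (1 + q) `^ a
                      - 2 / Num.sqrt (1 + q ^+ 2)))) /\
    (fun t : R => heat_content (fun x => x `^ (- a) * Xi1 x)
                               (fun x => x `^ (- b) * Xi2 x) t)
      = (fun t : R => beta0 - 2^-1 * ln t)
        +O_ (0^'+) (fun t : R => Num.sqrt t * ln t).
Proof.
have a01 : 0 < a < 1 by rewrite ha andbT -(ltrD2r b) hab add0r.
have [d1 [L1 [d10 d1h L10 bY1]]] := cutoff01_bump hXi1.
have [d2 [L2 [d20 d2h L20 bY2]]] := cutoff01_bump hXi2.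
have X1 (X : R -> R) : cutoff X -> X 1 = 0.
  move=> [_ _ _ [U [_ UI UX]]]; apply: UX; last by rewrite ler01 lexx.
  by apply: UI; rewrite /= in_itv/= lexx andbT invf_le1// ler1n.
(* Halved because [s (1 + q)] can come close to [2 s]: for [s <= d] both arguments must stay in the
   plateaus. *)
pose d := Num.min d1 d2 / 2.
have d0 : 0 < d by rewrite divr_gt0// lt_min d10 d20.
have dE : 2 * d = Num.min d1 d2 by rewrite /d mulrC divfK.
have dd1 : 2 * d <= d1 by rewrite dE ge_min lexx.
have dd2 : 2 * d <= d2 by rewrite dE ge_min lexx orbT.
have dh : d < 2^-1 by lra.
pose H := \int[lebesgue_measure]_(x in `[d, 2^-1]) (cutoff01 Xi1 x * cutoff01 Xi2 x * x^-1).
pose W := \int[lebesgue_measure]_(q in `[0, 1]) (q^-1 * (sym_weight a q - 2)).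
exists (2^-1 * W + (H + ln d + 2^-1 * euler_gamma R + ln 2)); split.
  near=> eps.
  have e0 : 0 < eps by near: eps; exact: nbhs_right_gt.
  have ed : eps <= d by near: eps; exact: nbhs_right_le.
  rewrite (bump_integral_shift bY1 bY2 dd1 dd2 dh e0 ed) -/H.
  rewrite (_ : \int[lebesgue_measure]_(q in `[0, 1]) _ = \int[lebesgue_measure]_(q in `[0, 1])
      (q^-1 * (sym_weight a q - 2 / Num.sqrt (1 + q ^+ 2)))); last first.
    by apply: eq_Rintegral => q _; rewrite /sym_weight /weight opprK.
  (* [ln eps] and [ln (sqrt 2 - 1)] each cancel, and [2 ln 2 - ln 2] leaves the [ln 2] of the
     witness. *)
  by rewrite Rintegral_sym_weight// -/W lnXn// -mulr_natr; field.
have [C C0 HC] : exists2 C : R, 0 <= C & forall t, 0 < t ->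
    `|heat_content (fun x => x `^ (- a) * Xi1 x) (fun x => x `^ (- b) * Xi2 x) t -
      (2^-1 * W + (H + ln d + 2^-1 * euler_gamma R + ln 2) - 2^-1 * ln t)| <= C * Num.sqrt t.
  pose C1 := ((L1 + L2) / (Num.sqrt pi * d ^+ 2) + (Num.sqrt pi * d)^-1) *
    \int[lebesgue_measure]_(q in `[0, 1]) (sym_weight a q) + (L1 + L2) / (Num.sqrt pi * d ^+ 2).
  pose C2 := 2 / (Num.sqrt pi * d ^+ 2) + (Num.sqrt pi / 2 * d)^-1.
  have HC t : 0 < t ->
    `|heat_content (fun x => x `^ (- a) * Xi1 x) (fun x => x `^ (- b) * Xi2 x) t -
      (2^-1 * W + (H + ln d + 2^-1 * euler_gamma R + ln 2) - 2^-1 * ln t)| <= (C1 + C2) *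
        Num.sqrt t.
    move=> t0; have B1 := heat_integral_dist a01 t0 bY1 bY2 L10 L20 d0 dd1 dd2 dh.
    have B2 := diag_integral_asymp t0 bY1 bY2 d0 dd1 dd2 dh.
    rewrite (heat_content_slice a01 hab t0 bY1 bY2 erefl erefl (X1 _ hXi1) (X1 _ hXi2)).
    rewrite -/H -/C2 in B2; rewrite -/W -/C1 in B1.
    set D := \int[lebesgue_measure]_(q in _) diag_int t _ _ q in B1 B2.
    set I := \int[lebesgue_measure]_(q in _) _ in B1 *.
    rewrite (_ : I - _ = (I - (2^-1 * W + 2 * D)) +
      (2 * D - (H + ln d + 2^-1 * euler_gamma R + ln 2 - 2^-1 * ln t))); last by ring.
    rewrite [leRHS]mulrDl; apply: (le_trans (ler_normD _ _)); exact: lerD.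
  exists `|C1 + C2| => // t t0; apply: (le_trans (HC t t0)).
  by rewrite ler_wpM2r// ler_norm.
apply/eqaddOP; exists C; split; first exact: num_real.
move=> k Ck; near=> t.
have t0 : 0 < t by near: t; exact: nbhs_right_gt.
(* Below [e^-1] one has [|ln t| >= 1], so the bound [C sqrt t] implies the stated one. *)
have te : t <= expR (-1) by near: t; apply: nbhs_right_le; exact: expR_gt0.
apply: (le_trans (HC t t0)); rewrite normrM (ger0_norm (sqrtr_ge0 _)).
have lt1 : 1 <= `|ln t|.
  have : ln t <= -1 by rewrite -(expRK (-1)) ler_ln ?posrE// expR_gt0.
  by rewrite ler_normr => h; apply/orP; right; rewrite lerNr.
rewrite -[leLHS]mulr1 -mulrA; apply: ler_pM => //; first exact: ltW.
by apply: ler_wpM2l => //; exact: sqrtr_ge0.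
Unshelve. all: by end_near.
Qed.
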